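(* Every indecomposable linear representation of a primitive poset of finite type can be unitarized with some weight. That is, if $\mathcal N=\{1,\dots,n\}$ is a primitive poset of finite type and $\pi=(V;V_1,\dots,V_n)$ is an indecomposable linear representation of $\mathcal N$, then there is a weight $\chi=(\alpha_1,\dots,\alpha_n;\gamma)\in\mathbb R_+^{n+1}$ (all $\alpha_i$ and $\gamma$ positive real numbers) such that $\pi$ can be unitarized with weight $\chi$.
   Context: For positive integers $k_1,\dots,k_m$, the primitive poset $(k_1,\dots,k_m)$ is the cardinal (disjoint) sum of $m$ linearly ordered sets with $k_1,\dots,k_m$ elements (elements of different chains are incomparable). A linear representation $\pi=(V;V_1,\dots,V_n)$ of a finite poset $\mathcal N=\{1,\dots,n\}$ with order $\prec$ is a finite-dimensional complex vector space $V$ together with a subspace $V_i\subseteq V$ for each $i\in\mathcal N$ such that $i\prec j$ implies $V_i\subseteq V_j$. Two representations $(V;V_1,\dots,V_n)$ and $(W;W_1,\dots,W_n)$ are isomorphic if there is an invertible linear map $C:V\to W$ with $C(V_i)=W_i$ for all $i$. Their direct sum is $(V\oplus W;V_1\oplus W_1,\dots,V_n\oplus W_n)$. A representation is indecomposable if it is not isomorphic to a direct sum of two non-zero representations. The poset $\mathcal N$ has finite type if it has only finitely many indecomposable linear representations up to isomorphism. A weight is a vector $\chi=(\alpha_1,\dots,\alpha_n;\gamma)\in\mathbb R_+^{n+1}$, where $\alpha_1,\dots,\alpha_n$ and $\gamma$ are positive real numbers. The representation $\pi$ can be unitarized with weight $\chi$ if there is a choice of Hermitian structure (Hermitian inner product)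 on $V$ such that the orthogonal projections $P_i$ of $V$ onto $V_i$ satisfy $\alpha_1P_1+\dots+\alpha_nP_n=\gamma I$, where $I$ is the identity operator on $V$.
   Formalization: The indecomposable representation with V of dimension 1 and all V_i = 0 is excluded up to isomorphism: there every P_i = 0, so the sum of the α_i P_i is 0 and cannot equal γI with γ > 0. *)

(* Defs.v *)
From HB Require Import structures.
From mathcomp Require Import all_boot all_order all_algebra.
From mathcomp Require Import sesquilinear complex.
From mathcomp Require Import reals.

Set Implicit Arguments.
Unset Strict Implicit.
Unset Printing Implicit Defensive.

Import Order.TTheory GRing.Theory Num.Theory Num.Def.
Local Open Scope ring_scope.
Local Open Scope complex_scope.

Definition chain_sum_le m (k : 'I_m -> nat) (x y : {i : 'I_m & 'I_(k i)}) : bool :=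
  (tag x == tag y) && (tagged x <= tagged y)%N.

Definition primitive_poset d (T : finPOrderType d) : Prop :=
  exists (m : nat) (k : 'I_m -> nat) (h : T -> {i : 'I_m & 'I_(k i)}),
    [/\ forall i, (0 < k i)%N, bijective h
      & forall x y : T, (x <= y)%O = chain_sum_le (h x) (h y)].

Record linrep (F : fieldType) d (T : finPOrderType d) := LinRep {
  rep_space : vectType F;
  rep_sub : T -> {vspace rep_space};
  rep_sub_mono : forall i j : T, (i < j)%O -> (rep_sub i <= rep_sub j)%VS
}.

Arguments rep_space {F d T} _.
Arguments rep_sub {F d T} _ _.

Section LinearRepresentations.
Variables (F : fieldType) (d : Order.disp_t) (T : finPOrderType d).
Implicit Types pi rho sigma : linrep F T.

Definition linrep_iso pi rho : Prop :=
  exists C : 'Hom(rep_space pi, rep_space rho),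
    bijective C /\ forall i, (C @: rep_sub pi i)%VS = rep_sub rho i.

Definition dsumv (V W : vectType F) (U : {vspace V}) (U' : {vspace W}) :
    {vspace (V * W)%type} :=
  (linfun (@fst V W) @^-1: U :&: linfun (@snd V W) @^-1: U')%VS.

Lemma memv_dsumv (V W : vectType F) (U : {vspace V}) (U' : {vspace W}) x :
  (x \in dsumv U U') = (x.1 \in U) && (x.2 \in U').
Proof. by rewrite memv_cap -!memv_preim !lfunE. Qed.

Lemma dsumvS (V W : vectType F) (U1 U2 : {vspace V}) (U1' U2' : {vspace W}) :
  (U1 <= U2)%VS -> (U1' <= U2')%VS -> (dsumv U1 U1' <= dsumv U2 U2')%VS.
Proof.
move=> /subvP s /subvP s'; apply/subvP => x; rewrite !memv_dsumv.
by case/andP=> /s -> /s' ->.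
Qed.

Definition linrep_dsum pi rho : linrep F T :=
  @LinRep F d T (rep_space pi * rep_space rho)%type
    (fun i => dsumv (rep_sub pi i) (rep_sub rho i))
    (fun i j ij => dsumvS (rep_sub_mono pi ij) (rep_sub_mono rho ij)).

Definition linrep_nonzero pi : Prop := \dim {: rep_space pi} <> 0%N.

(* By this definition the zero representation is indecomposable. *)
Definition linrep_indecomposable pi : Prop :=
  forall rho sigma, linrep_nonzero rho -> linrep_nonzero sigma ->
    ~ linrep_iso pi (linrep_dsum rho sigma).

(* The representation (F; 0, ..., 0). *)
Definition null_linrep : linrep F T :=
  @LinRep F d T F^o (fun=> 0%VS) (fun _ _ _ => subvv _).

End LinearRepresentations.

Definition finite_rep_type (F : fieldType) d (T : finPOrderType d) : Prop :=
  exists (N : nat) (s : 'I_N -> linrep F T),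
    forall pi : linrep F T,
      linrep_indecomposable pi -> exists i, linrep_iso pi (s i).

Definition orthogonal_projection (C : numClosedFieldType) (V : vectType C)
    (form : {dot V for conjC}) (U : {vspace V}) (P : 'End(V)) : Prop :=
  forall v, P v \in U /\ forall u, u \in U -> form (v - P v) u = 0.

Definition unitarizable_with (R : realType) d (T : finPOrderType d)
    (pi : linrep R[i] T) (alpha : T -> R) (gamma : R) : Prop :=
  exists (form : {dot (rep_space pi) for conjC})
         (P : T -> 'End(rep_space pi)),
    (forall i, orthogonal_projection form (rep_sub pi i) (P i)) /\
    \sum_i (alpha i)%:C *: P i = gamma%:C *: \1%VF.

(* The two lemmas below show that (C; 0, ..., 0) is indecomposable, but that it
   has no unitarization with a weight whose last entry gamma is positive: the
   projections are all 0 and the identity is not. *)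
Lemma null_linrep_indecomposable (F : fieldType) d (T : finPOrderType d) :
  linrep_indecomposable (null_linrep F T).
Proof.
move=> rho sigma nz_rho nz_sigma [C [bijC _]].
have pos (pi : linrep F T) :
    linrep_nonzero pi -> exists2 v : rep_space pi, v \in fullv & v != 0.
  move=> nz; exists (vpick {: rep_space pi}); first exact: memv_pick.
  by rewrite vpick0 -dimv_eq0; apply/eqP.
have [u _ u0] := pos _ nz_rho; have [v _ v0] := pos _ nz_sigma.
have [D CK DK] := bijC.
pose a : F := D (u, 0); pose b : F := D (0, v).
have Ea : C a = (u, 0) by rewrite DK.
have Eb : C b = (0, v) by rewrite DK.
have Cs (x : F) : C (x : F^o) = x *: C (1 : F^o).
  by rewrite -linearZ /=; congr (C _); rewrite /GRing.scale /= mulr1.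
have E : b *: C (a : F^o) = a *: C (b : F^o).
  by rewrite (Cs a) (Cs b) !scalerA mulrC.
have b0 : b = 0.
  move: E; rewrite Ea Eb => -[/eqP]; rewrite scaler0 scaler_eq0 (negPf u0) orbF.
  by move/eqP.
by move: Eb; rewrite b0 linear0 => -[/esym/eqP]; rewrite (negPf v0).
Qed.

Lemma null_linrep_not_unitarizable (R : realType) d (T : finPOrderType d)
    (alpha : T -> R) (gamma : R) :
  0 < gamma -> ~ unitarizable_with (null_linrep R[i] T) alpha gamma.
Proof.
move=> g0 [form [P [projP /lfunP/(_ (1 : R[i]^o)) E]]].
move: E; rewrite sum_lfunE big1 => [|i _].
  rewrite scale_lfunE id_lfunE => /esym/eqP; rewrite scaler_eq0 oner_eq0 orbF.
  by rewrite fmorph_eq0 gt_eqF.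
rewrite scale_lfunE; have [/= + _] := projP i (1 : R[i]^o).
by rewrite memv0 => /eqP ->; rewrite scaler0.
Qed.

(* Main.v *)
(* A poset that is a sum of chains is handled like a star-shaped quiver, whose
   representations form a hereditary category.  Finite type forces an
   indecomposable X to be a brick (only scalar endomorphisms) with
   Ext^1(X, X) = 0: a brick with a nonsplit self-extension carries
   indecomposable towers of arbitrary length, and by an argument of Ringel an
   indecomposable which is not a brick contains a smaller indecomposable Y with
   Ext^1(Y, Y) <> 0.

   For a subspace 0 < U < X, the vanishing of Hom(X, U) and of Ext^1(U, X) and
   the existence of the inclusion U -> X give <X, U> <= 0 < <U, X> for the Euler
   form.  So X is stable for the weight i |-> dim X_(i+1) - dim X_(i-1) (i - 1 and
   i + 1 being the neighbours of i in its chain), and stability survives a small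
   perturbation which makes the weight positive.

   For a stable X with integral weights, the scale-invariant function
   H |-> prod_i det (H|X_i)^(a_i) / det H^g on positive definite hermitian forms
   attains its minimum: writing H = w diag(lambda) w^*, the Cauchy-Binet formula
   bounds it from below, locally uniformly in w, by a constant over a ratio
   lambda_j / lambda_(j-1) of consecutive eigenvalues.  At a minimum the first
   variation vanishes, which says that sum_i a_i P_i = g. *)

Require Import Defs.
From HB Require Import structures.
From mathcomp Require Import all_boot all_order all_algebra.
From mathcomp Require Import fingroup perm sesquilinear spectral complex.
From mathcomp Require Import zify ring lra.
From mathcomp Require Import reals boolp.
From mathcomp Require classical_sets topology normedtype derive.

Set Implicit Arguments.
Unset Strict Implicit.
Unset Printing Implicit Defensive.

Import Order.TTheory GRing.Theory Num.Theory Num.Def.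
Local Open Scope ring_scope.

(** * Idempotents, bricks and subrepresentations *)

(** No list of indecomposables or of posets enters: finite type is used only against indecomposables
    of unbounded dimension. [Ext^1] is handled through the cochain condition [rigid], with one
    endomorphism per arm instead of one per element: a single arm is a flag, from which every
    subspace with its induced flag splits off, so only the gluing of the arms along the common space
    can be obstructed. Algebraic closedness serves to turn a non-scalar endomorphism into a singular
    one, by subtracting an eigenvalue.

    Stability is a strict inequality between integers, so a weight scaled by a large factor absorbs
    the perturbation that makes it positive. Natural weights also keep the function to be minimized
    a quotient of products of powers of determinants, whose first variation is the derivative of a
    polynomial. The representation excluded in the statement is the case where the right-hand side
    of the weight would be 0; the zero representation, which counts as indecomposable, is settled
    apart. *)

Lemma linfun_linear (F : fieldType) (V W : vectType F) (f : V -> W) :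
  linear f -> linfun f =1 f.
Proof.
move=> lf; pose f' : {linear V -> W} := HB.pack f (GRing.isLinear.Build F V W _ f lf).
exact: (lfunE f').
Qed.

Lemma lfun_of_linear (F : fieldType) (V W : vectType F) (f : V -> W) :
  linear f -> exists g : 'Hom(V, W), g =1 f.
Proof. by move=> lf; exists (linfun f); apply: linfun_linear. Qed.

Section Idempotents.
Variables (F : fieldType) (d : Order.disp_t) (T : finPOrderType d).
Implicit Types X Y : linrep F T.

Definition linrep_hom X Y (f : 'Hom(rep_space X, rep_space Y)) : Prop :=
  forall i v, v \in rep_sub X i -> f v \in rep_sub Y i.

Definition brick X : Prop :=
  forall f, linrep_hom (X := X) (Y := X) f -> exists a, f = a *: \1%VF.

Lemma subrep_mono X (U : {vspace rep_space X}) (i j : T) : (i < j)%O ->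
  (linfun (@vsval _ _ U) @^-1: rep_sub X i <= linfun (@vsval _ _ U) @^-1: rep_sub X j)%VS.
Proof. by move=> ij; apply/lpreimS/rep_sub_mono. Qed.

(** The subspaces are the traces of the [rep_sub X i] on [U], the largest ones for which the
    inclusion of [U] is a morphism. *)
Definition subrep X (U : {vspace rep_space X}) : linrep F T :=
  LinRep (@subrep_mono X U).

Lemma mem_subrep X (U : {vspace rep_space X}) i (w : subvs_of U) :
  (w \in rep_sub (subrep U) i) = (vsval w \in rep_sub X i).
Proof. by rewrite /= -memv_preim lfunE. Qed.

Lemma dim_subvs (V : vectType F) (U : {vspace V}) : \dim {:subvs_of U} = \dim U.
Proof. by rewrite dimvf. Qed.

(** Both [e] and 1 - [e] preserve every [rep_sub X i], so [X] is the direct sum of its traces on the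
    image and on the kernel of [e]. *)
Lemma indecomposable_idempotent X (e : 'End(rep_space X)) :
  linrep_indecomposable X -> linrep_hom (X := X) (Y := X) e ->
  (forall v, e (e v) = e v) -> e = 0 \/ e = \1%VF.
Proof.
move=> indX he ee; have [->|e0] := eqVneq e 0; [by left | right].
apply/eqP; apply/negPn/negP => e1.
have memk v : v - e v \in lker e by rewrite memv_ker linearB /= ee subrr.
have memi v : e v \in limg e by rewrite memv_img ?memvf.
apply: (indX (subrep (limg e)) (subrep (lker e))).
- rewrite /linrep_nonzero dim_subvs; apply/eqP; rewrite dimv_eq0.
  apply: contraNneq e0 => E; apply/eqP/lfunP => v.
  by have := memi v; rewrite E memv0 zero_lfunE => /eqP.
- rewrite /linrep_nonzero dim_subvs; apply/eqP; rewrite dimv_eq0.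
  apply: contraNneq e1 => E; apply/eqP/lfunP => v.
  by have := memk v; rewrite E memv0 id_lfunE subr_eq0 => /eqP.
have [|C CE] := @lfun_of_linear F (rep_space X)
   (rep_space (subrep (limg e)) * rep_space (subrep (lker e)))%type
   (fun v => (vsproj (limg e) (e v), vsproj (lker e) (v - e v))).
  move=> a u v; have E x y : vsproj (lker e) (a *: x + y)
      = a *: vsproj (lker e) x + vsproj (lker e) y by rewrite linearP.
  congr pair; rewrite /=; first by rewrite !linearP.
  by rewrite -E [e _]linearP scalerBr opprD addrACA.
have CK : cancel C (fun w => vsval w.1 + vsval w.2).
  by move=> v; rewrite CE /= !vsprojK // addrC subrK.
have KC : cancel (fun w => vsval w.1 + vsval w.2) C.
  move=> [[x xP] [y yP]]; rewrite CE /= linearD /=.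
  have ex : e x = x by case/memv_imgP: (xP) => u _ ->; rewrite ee.
  have ey : e y = 0 by apply/eqP; rewrite -memv_ker.
  rewrite ex ey addr0 addrC addKr.
  by congr pair; apply: val_inj; rewrite /= vsprojK.
exists C; split; first by exists (fun w => vsval w.1 + vsval w.2).
move=> i; apply/vspaceP => w; rewrite memv_dsumv !mem_subrep.
apply/memv_imgP/andP => [[v vi ->]|[w1 w2]].
  rewrite CE /= !vsprojK //; split; first exact: he.
  by rewrite rpredB // he.
by exists (vsval w.1 + vsval w.2); rewrite ?KC // rpredD.
Qed.

Lemma idempotent_indecomposable X :
  (forall e : 'End(rep_space X), linrep_hom (X := X) (Y := X) e ->
     (forall v, e (e v) = e v) -> e = 0 \/ e = \1%VF) ->
  linrep_indecomposable X.
Proof.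
move=> idX rho sigma nz_rho nz_sigma [C [[D CK DK] Cs]].
have Dlin : linear D.
  by move=> a u v; rewrite -{1}[u]DK -{1}[v]DK -linearP CK.
have [|e eE] := @lfun_of_linear F (rep_space X) (rep_space X)
    (fun v => D ((C v).1, 0)).
  move=> a u v /=; rewrite -Dlin; congr D; rewrite linearP /=.
  by congr pair; rewrite /= ?scaler0 ?addr0.
have nzv (Y : linrep F T) : linrep_nonzero Y -> exists w : rep_space Y, w != 0.
  move=> nz; exists (vpick {: rep_space Y}).
  by rewrite vpick0 -dimv_eq0; apply/eqP.
have [w1 w10] := nzv _ nz_rho; have [w2 w20] := nzv _ nz_sigma.
case: (idX e) => [i v vi|v||].
- rewrite eE; have : C v \in dsumv (rep_sub rho i) (rep_sub sigma i).
    by have := Cs i => /= <-; rewrite memv_img.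
  rewrite memv_dsumv => /andP[v1 v2].
  have : ((C v).1, 0) \in dsumv (rep_sub rho i) (rep_sub sigma i).
    by rewrite memv_dsumv /= v1 mem0v.
  by have := Cs i => /= <- /memv_imgP[u ui ->]; rewrite CK.
- by rewrite !eE DK.
- move=> E; have := eE (D (w1, 0)); rewrite E zero_lfunE DK /= => /(congr1 C).
  by rewrite linear0 DK => -[/esym/eqP]; rewrite (negPf w10).
- move=> E; have := eE (D (0, w2)); rewrite E id_lfunE DK /= => /(congr1 C).
  by rewrite !DK => -[/eqP]; rewrite (negPf w20).
Qed.

End Idempotents.

(** * Towers of self-extensions of a brick *)

Section SelfExtensions.
Variables (F : fieldType) (d : Order.disp_t) (T : finPOrderType d).
Variables (I : Type) (kappa : T -> I).
Hypothesis kappa_lt : forall i j : T, (i < j)%O -> kappa i = kappa j.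
Implicit Type X : linrep F T.

(* The vanishing of Ext^1(X, X) in the representations of the star-shaped
   quiver whose arms are the classes of kappa. *)
Definition rigid X : Prop :=
  forall g : I -> 'End(rep_space X), exists f : 'End(rep_space X),
    forall i v, v \in rep_sub X i -> f v - g (kappa i) v \in rep_sub X i.

Section Tower.
Variables (X : linrep F T) (g : I -> 'End(rep_space X)) (n : nat).
Let V := rep_space X.
Let W := {ffun 'I_n -> V}.

(** The degree [k] is any natural number and degrees from [n] on give 0, so that the shift out of
    the top degree needs no separate case. *)
Definition tower_in (k : nat) : 'Hom(V, W) :=
  linfun (fun v => [ffun l : 'I_n => if l == k :> nat then v else 0]).

Lemma tower_inE k v (l : 'I_n) : tower_in k v l = if l == k :> nat then v else 0.
Proof.
rewrite linfun_linear ?ffunE // => a u w; apply/ffunP => x; rewrite !ffunE.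
by case: eqP => _ //; rewrite scaler0 addr0.
Qed.

Lemma tower_in_out k v : (n <= k)%N -> tower_in k v = 0.
Proof.
move=> nk; apply/ffunP => l; rewrite tower_inE ffunE ltn_eqF //.
exact: leq_trans (ltn_ord l) nk.
Qed.

Definition tower_proj (l : 'I_n) : 'Hom(W, V) := linfun (fun w : W => w l).

Lemma tower_projE l w : tower_proj l w = w l.
Proof.
by rewrite linfun_linear // => a u v; rewrite !ffunE.
Qed.

Lemma tower_sum (w : W) : w = \sum_(k < n) tower_in k (w k).
Proof.
apply/ffunP => l; rewrite sum_ffunE (bigD1 l) //= tower_inE eqxx big1 ?addr0 //.
by move=> k kl; rewrite tower_inE val_eqE eq_sym (negPf kl).
Qed.

Definition tower_shift i k : 'Hom(V, W) := tower_in k + (tower_in k.+1 \o g (kappa i))%VF.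

(* (1 + t g_c)(X_i (x) F[t]/t^n) for i in the arm c, where t shifts the summands
   of V^n. *)
Definition tower_sub i : {vspace W} := (\sum_(k < n) tower_shift i k @: rep_sub X i)%VS.

Lemma tower_sub_mono i j : (i < j)%O -> (tower_sub i <= tower_sub j)%VS.
Proof.
move=> ij; apply/subv_sumP => k _; apply: subv_trans (sumv_sup k _ (subvv _)) => //.
by rewrite /tower_shift (kappa_lt ij); apply/limgS/rep_sub_mono.
Qed.

Definition tower : linrep F T := LinRep tower_sub_mono.

Lemma tower_shift_mem i k v : (k < n)%N -> v \in rep_sub X i ->
  tower_shift i k v \in tower_sub i.
Proof.
move=> kn vi; apply: (subvP (sumv_sup (Ordinal kn) (erefl _) (subvv _))).
exact: memv_img.
Qed.

Lemma tower_sub_coords i w : w \in tower_sub i ->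
  exists2 u : nat -> V, forall k, u k \in rep_sub X i &
    forall l : 'I_n, w l = u l + (if l : nat is l'.+1 then g (kappa i) (u l') else 0).
Proof.
case/memv_sumP => s sP ->.
have /choice[u uP] (k : 'I_n) :
    exists u, u \in rep_sub X i /\ s k = tower_shift i k u.
  by have /memv_imgP[u ui ->] := sP k isT; exists u.
exists (fun k => if insub k is Some k' then u k' else 0) => [k|l].
  by case: insubP => [k' _ _|_]; [have [] := uP k' | rewrite mem0v].
rewrite sum_ffunE.
under eq_bigr => k _ do rewrite (proj2 (uP k)) add_lfunE ffunE comp_lfunE !tower_inE.
rewrite big_split /=; congr (_ + _).
  rewrite (bigD1 l) //= eqxx big1 ?addr0 ?valK // => k kl.
  by rewrite val_eqE eq_sym (negPf kl).
case: l => [[|l] ln] /=; first by rewrite big1.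
have ln' : (l < n)%N by apply: ltnW.
rewrite (bigD1 (Ordinal ln')) //= eqxx big1 ?addr0 => [|k].
  by congr (g _ _); rewrite insubT.
rewrite -val_eqE /= => kl; case: ifP => // /eqP[E]; by rewrite E eqxx in kl.
Qed.

Hypothesis brickX : brick X.
Hypothesis nosplit : ~ exists f : 'End(V),
  forall i v, v \in rep_sub X i -> f v - g (kappa i) v \in rep_sub X i.

(** The lowest coordinate of [psi] that can be nonzero is an endomorphism of the brick [X], hence a
    scalar [a]. If there is a next coordinate and [a] is nonzero, then that coordinate divided by
    [a] splits [g]. So everything below the top degree vanishes. *)
Lemma hom_to_tower (psi : 'Hom(V, W)) :
  linrep_hom (X := X) (Y := tower) psi ->
  exists a, forall v, psi v = a *: tower_in n.-1 v.
Proof.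
move=> hpsi.
have endo (k : 'I_n) : (forall (l : 'I_n) v, (l < k)%N -> psi v l = 0) ->
    exists2 a, forall v, psi v k = a *: v &
    forall l : 'I_n, l = k.+1 :> nat -> a = 0.
  move=> psi0.
  have key i v : v \in rep_sub X i -> psi v k \in rep_sub X i /\
      forall l : 'I_n, l = k.+1 :> nat -> psi v l - g (kappa i) (psi v k) \in rep_sub X i.
    move=> vi; have [u ui uE] := tower_sub_coords (hpsi i v vi).
    have u0 l : (l < k)%N -> u l = 0.
      elim: l => [|l IH] lk.
        have := uE (Ordinal (ltn_trans lk (ltn_ord k))).
        by rewrite psi0 //= addr0.
      have := uE (Ordinal (ltn_trans lk (ltn_ord k))).
      by rewrite psi0 //= IH ?linear0 ?addr0 // ltnW.
    have uk : psi v k = u k.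
      rewrite uE; case Ek: (k : nat) => [|l]; first by rewrite addr0.
      by rewrite (u0 l) ?linear0 ?addr0 ?Ek.
    by rewrite uk ui; split=> // l lk; rewrite uE lk addrK.
  have [|a aE] := brickX (f := (tower_proj k \o psi)%VF).
    by move=> i v vi; rewrite comp_lfunE tower_projE; have [] := key i v vi.
  have {}aE v : psi v k = a *: v.
    have := aE; move/lfunP/(_ v).
    by rewrite comp_lfunE tower_projE scale_lfunE id_lfunE.
  exists a => // l lk; apply/eqP/negPn/negP => a0; apply: nosplit.
  exists (a^-1 *: (tower_proj l \o psi)%VF) => i v vi.
  have [_ /(_ l lk)] := key i v vi; rewrite aE linearZ /= => E.
  rewrite scale_lfunE comp_lfunE tower_projE.
  rewrite -[g _ v](scalerK a0) -scalerBr; exact: memvZ.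
have psi0 (k : 'I_n) v : (k.+1 < n)%N -> psi v k = 0.
  move: k v; suff H m : forall (k : 'I_n) v, (k < m)%N -> (k.+1 < n)%N -> psi v k = 0.
    by move=> k v; apply: (H k.+1).
  elim: m => // m IH k v; rewrite ltnS => km kn.
  have [|a aE /(_ (Ordinal kn))] := @endo k.
    move=> l w lk; apply: IH; first exact: leq_trans km.
    exact: ltn_trans kn.
  by move=> /(_ erefl) a0; rewrite aE a0 scale0r.
have [n0|n0] := posnP n.
  exists 0 => v; apply/ffunP => l; case: (l) => l' ln; exfalso.
  by rewrite n0 in ln.
have ln : (n.-1 < n)%N by rewrite prednK.
have [|a aE _] := @endo (Ordinal ln).
  by move=> l v /= ll; apply: psi0; lia.
exists a => v; apply/ffunP => l; rewrite ffunE tower_inE.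
have [ll|ll] := eqVneq (l : nat) n.-1.
  by have -> : l = Ordinal ln by apply: val_inj.
rewrite scaler0 psi0 //; have := ltn_ord l.
by move: ll => /eqP; lia.
Qed.

Lemma tower_dim : \dim {: rep_space tower} = (n * \dim {: V})%N.
Proof.
have E : \dim {: W} = (#|'I_n| * \dim {: V})%N by rewrite !dimvf.
by rewrite [LHS]E card_ord.
Qed.

Lemma tower_top_hom : linrep_hom (X := X) (Y := tower) (tower_in n.-1).
Proof.
move=> i v vi; have [n0|n0] := posnP n.
  by rewrite tower_in_out ?mem0v // n0.
have -> : tower_in n.-1 v = tower_shift i n.-1 v.
  by rewrite add_lfunE comp_lfunE prednK // [X in _ + X]tower_in_out ?addr0.
by apply: tower_shift_mem; rewrite ?prednK.
Qed.

(** Descending induction on the degree: once [e] kills degree [k.+1], it cannot distinguish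
    [tower_in k] from [tower_shift i k], so [e \o tower_in k] is a morphism from [X]. It lands in
    the top degree by [hom_to_tower], and there [e] kills it; idempotence concludes. *)
Lemma tower_idempotent0 (e : 'End(W)) : linrep_hom (X := tower) (Y := tower) e ->
  (forall w, e (e w) = e w) -> (forall v, e (tower_in n.-1 v) = 0) -> e = 0.
Proof.
move=> he ee e0.
have H m : forall k v, (n - m <= k)%N -> e (tower_in k v) = 0.
  elim: m => [|m IH] k v nk; first by rewrite tower_in_out ?linear0 // -[n]subn0.
  have [kn|kn] := ltnP k n; last by rewrite tower_in_out ?linear0.
  have IHk w : e (tower_in k.+1 w) = 0 by apply: IH; move: nk; rewrite !leq_subLR addSnnS.
  have [|a aE] := hom_to_tower (psi := (e \o tower_in k)%VF).
    move=> i w wi; rewrite comp_lfunE.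
    have -> : e (tower_in k w) = e (tower_shift i k w).
      by rewrite add_lfunE comp_lfunE linearD /= IHk addr0.
    by apply: he; apply: tower_shift_mem.
  rewrite -ee; have := aE v; rewrite comp_lfunE => ->.
  by rewrite linearZ /= e0 scaler0.
apply/lfunP => w; rewrite zero_lfunE (tower_sum w) linear_sum big1 // => k _.
by apply: (H n); rewrite subnn.
Qed.

(** An idempotent acts on the top copy of [X] by a scalar, and thus [e] or 1 - [e] kills that
    copy. *)
Lemma tower_indecomposable : linrep_indecomposable tower.
Proof.
apply: idempotent_indecomposable => e he ee.
have [|a aE] := hom_to_tower (psi := (e \o tower_in n.-1)%VF).
  by move=> i v vi; rewrite comp_lfunE; apply/he/tower_top_hom.
have {}aE v : e (tower_in n.-1 v) = a *: tower_in n.-1 v by rewrite -aE comp_lfunE.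
have [a0|a0] := eqVneq a 0.
  by left; apply: tower_idempotent0 => // v; rewrite aE a0 scale0r.
right; suff : \1%VF - e = 0 by move/subr0_eq.
apply: tower_idempotent0 => [i w wi|w|v].
- by rewrite add_lfunE opp_lfunE id_lfunE rpredB // he.
- by rewrite !add_lfunE !opp_lfunE !id_lfunE linearB /= ee subrr subr0.
rewrite add_lfunE opp_lfunE id_lfunE; apply: (scalerI a0).
by rewrite scaler0 scalerBr -aE -linearZ /= -aE ee subrr.
Qed.

End Tower.

Lemma finite_type_brick_rigid X : finite_rep_type F T -> brick X -> rigid X.
Proof.
move=> [N [s sP]] brickX; apply: contrapT => nrig.
have /asboolPn/asboolP/existsNP[g nosplit] : ~ rigid X by [].
have V0 : (0 < \dim {: rep_space X})%N.
  rewrite lt0n; apply: contra_notN nosplit => /eqP V0.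
  have all0 (v : rep_space X) : v = 0.
    have := memvf v; suff -> : fullv = 0%VS :> {vspace rep_space X} by rewrite memv0 => /eqP.
    by apply/eqP; rewrite -dimv_eq0 V0.
  by exists 0 => i v _; rewrite [_ - _]all0 mem0v.
(* [D] exceeds every dimension in the finite list, and a tower of height [D] over a nonzero space
   has dimension at least [D]. *)
pose D := (\max_(i < N) \dim {: rep_space (s i)}).+1.
have [i [C [[C' CK _] _]]] := sP _ (tower_indecomposable (n := D) brickX nosplit).
have : (\dim {: rep_space (tower g D)} <= \dim {: rep_space (s i)})%N.
  have /lker0P ker0 : injective C by apply: can_inj CK.
  by rewrite -(limg_dim_eq (f := C)) ?dimvS ?subvf // (eqP ker0) capv0.
rewrite tower_dim => le; have : (D <= \dim {: rep_space (s i)})%N.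
  by apply: leq_trans le; rewrite leq_pmulr.
by rewrite /D ltnNge (leq_bigmax (F := fun i => \dim {: rep_space (s i)}) i).
Qed.

End SelfExtensions.

(** * Indecomposables which are not bricks *)

Lemma exists_minimal (A : Type) (P : A -> Prop) (m : A -> nat) :
  (exists x, P x) -> exists2 x, P x & forall y, P y -> (m x <= m y)%N.
Proof.
move=> [x Px].
have ex : exists k, `[< exists2 y, P y & m y = k >] by exists (m x); apply/asboolP; exists x.
case: (ex_minnP ex) => k /asboolP[y Py <-] kmin; exists y => // z Pz.
by apply: kmin; apply/asboolP; exists z.
Qed.

Import passmx.

(** * Retractions compatible with a flag, and eigenvectors *)

Section VectorSpaces.
Variables (F : fieldType) (V : vectType F).
Implicit Types (U K : {vspace V}) (f : 'End(V)).

Lemma daddv_pi0 U K v : (U :&: K = 0)%VS -> v \in K -> daddv_pi U K v = 0.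
Proof.
move=> UK vK; have := @daddv_pi_add _ _ U K v UK.
rewrite [daddv_pi K U v]daddv_pi_id // ?(capvC K U) // => /(_ _)/(canRL (addrK _)).
by rewrite subrr; apply; apply: subvP vK; apply: addvSr.
Qed.

(** From [U n] to [U n.+1] the map is extended by the identity on a complement [C] of the trace of
    [U n] in [U n.+1 :&: K]; as [C] meets [U n] only in 0, nothing changes on the smaller members of
    the flag. *)
Lemma flag_retraction (U : nat -> {vspace V}) K n :
  (forall j, (U j <= U j.+1)%VS) ->
  exists s : 'End(V), forall j, (j <= n)%N ->
    (forall v, v \in U j -> s v \in (U j :&: K)%VS) /\
    (forall v, v \in (U j :&: K)%VS -> s v = v).
Proof.
move=> Umono; elim: n => [|n [s sP]].
  exists (projv (U 0 :&: K)) => j; rewrite leqn0 => /eqP->.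
  by split=> v vU; rewrite ?memv_proj ?projv_id.
have UUn j : (j <= n)%N -> (U j <= U n)%VS.
  elim: n {s sP} => [|n IH]; first by rewrite leqn0 => /eqP->.
  by rewrite leq_eqVlt => /predU1P[->//|/IH/subv_trans]; apply.
pose B := (U n.+1 :&: K)%VS; pose C := (B :\: U n)%VS.
have UC0 : (U n :&: C = 0)%VS by rewrite capvC; apply: capv_diff.
have CU0 : (C :&: U n = 0)%VS by apply: capv_diff.
have [sU sK] := sP n (leqnn n).
pose s' := ((s \o daddv_pi (U n) C) + daddv_pi C (U n))%VF.
have s'E v : s' v = s (daddv_pi (U n) C v) + daddv_pi C (U n) v.
  by rewrite /s' add_lfunE comp_lfunE.
have s'U v : v \in U n -> s' v = s v.
  by move=> vU; rewrite s'E daddv_pi_id // [X in _ + X]daddv_pi0 ?addr0.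
have BS : (B <= U n + C)%VS by rewrite addvC addv_diff addvSl.
have UnB : (U n :&: K <= B)%VS by apply: capvS (Umono n) (subvv K).
have CB : (C <= B)%VS by apply: diffvSl.
exists s' => j; rewrite leq_eqVlt ltnS => /predU1P[->|jn]; last first.
  have [sUj sKj] := sP j jn; split=> v vj.
    by rewrite s'U ?sUj //; apply: (subvP (UUn j jn)).
  rewrite s'U ?sKj //; apply: (subvP (UUn j jn)).
  by move: vj; rewrite memv_cap => /andP[].
split=> v.
  move=> _; rewrite s'E; apply: memvD.
    by apply: (subvP UnB); apply/sU/memv_pi.
  by apply: (subvP CB); apply: memv_pi.
move=> vB; have := daddv_pi_add UC0 (subvP BS _ vB) => vE.
rewrite s'E sK // memv_cap memv_pi /=.
have : v - daddv_pi C (U n) v \in K.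
  have inK x : x \in B -> x \in K by rewrite memv_cap => /andP[].
  by apply: memvB; apply: inK => //; apply: (subvP CB); apply: memv_pi.
by rewrite -{1}vE addrK.
Qed.

End VectorSpaces.

Lemma closed_eigenvector (F : closedFieldType) (V : vectType F) (f : 'End(V)) :
  \dim {: V} != 0%N -> exists a, lker (f - a *: \1%VF) != 0%VS.
Proof.
move=> V0; pose e := vbasis {: V}.
have eB : basis_of {: V} e by apply: vbasisP.
pose M := mxof e e f.
have /closed_rootP[a ra] : size (char_poly M) != 1%N.
  by rewrite size_char_poly eqSS.
exists a; have := leigenspaceE eB f a; rewrite /leigenspace => ->.
by rewrite vsof_eq0 // -/(eigenvalue _ _) eigenvalue_root_char.
Qed.

Section Ringel.
Variables (F : closedFieldType) (d : Order.disp_t) (T : finPOrderType d).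
Implicit Type X : linrep F T.
Variables (I : Type) (kappa : T -> I).
Hypothesis retraction : forall X (K : {vspace rep_space X}) c,
  exists2 s : 'End(rep_space X), (forall v, s v \in K) /\ (forall v, v \in K -> s v = v) &
    forall i v, kappa i = c -> v \in rep_sub X i -> s v \in rep_sub X i.

Lemma subrep_indecomposable X (U : {vspace rep_space X}) :
  (forall e : 'End(rep_space X), (forall v, v \in U -> e v \in U) ->
     (forall v, v \in U -> e (e v) = e v) ->
     (forall i v, v \in U -> v \in rep_sub X i -> e v \in rep_sub X i) ->
     (forall v, v \in U -> e v = 0) \/ (forall v, v \in U -> e v = v)) ->
  linrep_indecomposable (subrep U).
Proof.
move=> idU; apply: idempotent_indecomposable => e' he' ee'.
pose e : 'End(rep_space X) := (linfun (@vsval _ _ U) \o e' \o linfun (vsproj U))%VF.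
have eE v : e v = vsval (e' (vsproj U v)) by rewrite /e !comp_lfunE !lfunE.
have eval w : e (vsval w) = vsval (e' w) by rewrite eE vsvalK.
case: (idU e) => [v _|v vU|i v vU vi|e0|e1].
- by rewrite eE subvsP.
- by rewrite [e v]eE eval ee'.
- by rewrite eE -mem_subrep; apply: he'; rewrite mem_subrep vsprojK.
- left; apply/lfunP => w; apply: val_inj => /=.
  by rewrite -eval e0 ?subvsP // zero_lfunE.
- by right; apply/lfunP => w; apply: val_inj; rewrite /= -eval e1 ?subvsP // id_lfunE.
Qed.

Lemma subrep_rigid X (U : {vspace rep_space X}) (g : I -> 'End(rep_space X)) :
  rigid kappa (subrep U) -> (forall c v, g c v \in U) ->
  exists2 f : 'End(rep_space X), forall v, f v \in U &
    forall i v, v \in U -> v \in rep_sub X i -> f v - g (kappa i) v \in rep_sub X i.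
Proof.
move=> rigU gU.
have [f' f'P] := rigU (fun c => linfun (vsproj U) \o g c \o linfun (@vsval _ _ U))%VF.
exists (linfun (@vsval _ _ U) \o f' \o linfun (vsproj U))%VF => [v|i v vU vi].
  by rewrite !comp_lfunE !lfunE subvsP.
have /(f'P i) : vsproj U v \in rep_sub (subrep U) i by rewrite mem_subrep vsprojK.
by rewrite mem_subrep linearB /= !comp_lfunE !lfunE /= !vsprojK.
Qed.

Section NotBrick.
Variable X : linrep F T.
Hypothesis indecX : linrep_indecomposable X.
Let V := rep_space X.

Definition singular_endo (f : 'End(V)) : Prop :=
  [/\ linrep_hom (X := X) (Y := X) f, f <> 0 & lker f <> 0%VS].

Variable phi : 'End(V).
Hypothesis phiS : singular_endo phi.
Hypothesis phi_min : forall f, singular_endo f -> (\dim (limg phi) <= \dim (limg f))%N.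

(* Otherwise phi would be injective on its image, a direct summand of X. *)
Lemma minimal_singular_square0 v : phi (phi v) = 0.
Proof.
have [hphi phi0 kphi0] := phiS.
move: v; suff : (phi \o phi)%VF = 0 by move=> /lfunP E v; rewrite -comp_lfunE E zero_lfunE.
apply: contrapT => pp0.
have /phi_min : singular_endo (phi \o phi)%VF.
  split=> //; first by move=> i v vi; rewrite comp_lfunE; apply/hphi/hphi.
  move=> E; apply: kphi0; apply/eqP; rewrite -subv0 -E; apply/subvP => v.
  by rewrite !memv_ker comp_lfunE => /eqP->; rewrite linear0.
rewrite limg_comp => le; have IK0 : (limg phi :&: lker phi = 0)%VS.
  apply/eqP; rewrite -dimv_eq0; move: (limg_ker_dim phi (limg phi)) le.
  by case: (\dim (_ :&: _)) => // k <-; rewrite addSn ltnNge leq_addl.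
pose e := daddv_pi (limg phi) (lker phi).
have eI v : v \in limg phi -> e v = v by apply: daddv_pi_id.
have eK v : v \in lker phi -> e v = 0 by apply: daddv_pi0.
case: (indecomposable_idempotent (e := e) indecX).
- move=> i v vi; have : phi v \in (phi @: (phi @: rep_sub X i))%VS.
    suff -> : (phi @: (phi @: rep_sub X i) = phi @: rep_sub X i)%VS by apply: memv_img.
    apply/eqP; rewrite eqEdim limgS /=; last first.
      by apply/subvP => _ /memv_imgP[w wi ->]; apply: hphi.
    rewrite (limg_dim_eq (U := (phi @: rep_sub X i)%VS)) //.
    apply/eqP; rewrite -subv0 -IK0 capvS //.
    by rewrite limgS // subvf.
  case/memv_imgP => _ /memv_imgP[w wi ->] E.
  have -> : v = phi w + (v - phi w) by rewrite addrC subrK.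
  rewrite linearD /= eI ?memv_img ?memvf // eK ?addr0; first exact: hphi.
  by rewrite memv_ker linearB /= E subrr.
- by move=> v; rewrite eI // memv_pi.
- move=> /lfunP E; apply: phi0; apply/lfunP => v.
  by have := E (phi v); rewrite !zero_lfunE eI // memv_img ?memvf.
- move=> /lfunP E; apply: kphi0; apply/eqP; rewrite -subv0; apply/subvP => v vK.
  by have := E v; rewrite id_lfunE eK // => <-; rewrite mem0v.
Qed.

Let K := lker phi.

(** Only the restriction of [p] to [K] matters: it is an idempotent endomorphism of [subrep K] that
    does not kill the image of [phi], which lies in [K] because [phi] has square 0. Minimal rank
    will make the image of [p] an indecomposable summand of [K]. *)
Definition kernel_idempotent (p : 'End(V)) : Prop :=
  [/\ forall v, v \in K -> p v \in K, forall v, v \in K -> p (p v) = p v,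
      forall i v, v \in K -> v \in rep_sub X i -> p v \in rep_sub X i &
      exists v, p (phi v) <> 0].

Variable p : 'End(V).
Hypothesis pP : kernel_idempotent p.
Hypothesis p_min : forall q, kernel_idempotent q -> (\dim (p @: K) <= \dim (q @: K))%N.

Let K' := (p @: K)%VS.

Let phiK v : phi v \in K. Proof. by rewrite memv_ker minimal_singular_square0. Qed.

Let K'K v : v \in K' -> v \in K.
Proof. by case: pP => pK _ _ _ /memv_imgP[u uK ->]; apply: pK. Qed.

Let pK' v : v \in K' -> p v = v.
Proof. by case: pP => _ pp _ _ /memv_imgP[u uK ->]; apply: pp. Qed.

Let p_img v : v \in K -> p v \in K'. Proof. exact: memv_img. Qed.

(** Of [e \o p] and [p - (e \o p)], at least one still does not kill the image of [phi]. It is then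
    a kernel idempotent with image inside [K'], and by minimality its image is all of [K'], which
    forces [e] to be 1 or 0 there. *)
Lemma kernel_summand_indecomposable : linrep_indecomposable (subrep K').
Proof.
have [pK pp ph [w pphi]] := pP.
apply: subrep_indecomposable => e eK ee he.
have surj q : kernel_idempotent q -> (forall v, v \in K -> q v \in K') ->
    forall v, v \in K' -> exists2 u, u \in K & v = q u.
  move=> qP qK' v vK'; apply/memv_imgP; move: vK'; suff -> : K' = (q @: K)%VS by [].
  apply/esym/eqP; rewrite eqEdim p_min // andbT.
  by apply/subvP => _ /memv_imgP[u uK ->]; apply: qK'.
have [ep0|ep0] := pselect (exists v, (e \o p)%VF (phi v) <> 0).
  right => v vK'; have [||u uK ->] := surj (e \o p)%VF _ _ v vK'.
  - split=> // [u uK|u uK|i u uK ui]; rewrite !comp_lfunE.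
    + exact/K'K/eK/p_img.
    + by rewrite (pK' (eK _ (p_img uK))) ee // p_img.
    + by apply: he (ph _ _ _ _); rewrite ?p_img.
  - by move=> u uK; rewrite comp_lfunE; apply/eK/p_img.
  by rewrite comp_lfunE ee // p_img.
left => v vK'; have [||u uK ->] := surj (p - (e \o p))%VF _ _ v vK'.
- split=> [u uK|u uK|i u uK ui|].
  + rewrite add_lfunE opp_lfunE comp_lfunE; apply/K'K/rpredB; first exact: p_img.
    exact/eK/p_img.
  + have puK := p_img uK; have epK := eK _ puK.
    have pE z : (p - (e \o p))%VF z = p z - e (p z).
      by rewrite add_lfunE opp_lfunE comp_lfunE.
    by rewrite !pE (pK' (rpredB puK epK)) linearB /= ee // subrr subr0.
  + rewrite add_lfunE opp_lfunE comp_lfunE; apply: rpredB; first exact: ph.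
    by apply: he; [exact: p_img | exact: ph].
  + exists w; have epw : (e \o p)%VF (phi w) = 0.
      by apply: contrapT => ne; apply: ep0; exists w.
    by rewrite add_lfunE opp_lfunE epw subr0.
- move=> u uK; rewrite add_lfunE opp_lfunE comp_lfunE; apply: rpredB; first exact: p_img.
  exact/eK/p_img.
rewrite add_lfunE opp_lfunE comp_lfunE linearB /= ee ?subrr //.
exact: p_img.
Qed.

Lemma kernel_summand_dim : (\dim {: rep_space (subrep K')} < \dim {: V})%N.
Proof.
have [_ phi0 _] := phiS; rewrite dim_subvs ltn_neqAle dimvS ?subvf // andbT.
apply: contra_notN phi0 => /eqP E; apply/lfunP => v; rewrite zero_lfunE; apply/eqP.
rewrite -memv_ker; apply: K'K; suff -> : K' = fullv by rewrite memvf.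
by apply/eqP; rewrite eqEdim subvf E /=.
Qed.

(* On each single arm the projection p of K = ker phi onto K' extends to X; the
   extensions differ by maps which factor through phi, hence through the
   embedding p phi of the image of phi into K'.  If K' were rigid they could be
   corrected to one retraction of X onto K'. *)
Lemma kernel_summand_not_rigid : ~ rigid kappa (subrep K').
Proof.
move=> rigK'; have [hphi phi0 kphi0] := phiS; have [pK pp ph [w pphi]] := pP.
pose q := (p \o phi)%VF.
have qE v : q v = p (phi v) by rewrite /q comp_lfunE.
have qK' v : q v \in K' by rewrite qE p_img.
have hq i v : v \in rep_sub X i -> q v \in rep_sub X i.
  by move=> vi; rewrite qE; apply: ph => //; apply: hphi.
have KkQ : (K <= lker q)%VS.
  by apply/subvP => v; rewrite !memv_ker qE => /eqP->; rewrite linear0.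
(* [q] is again a singular endomorphism, so the minimal rank of [phi] prevents its kernel from being
   larger than [K]. *)
have kq v : v \in lker q -> v \in K.
  apply: subvP v; have /geq_leqif <- := dimv_leqif_sup KkQ.
  have : (\dim (limg phi) <= \dim (limg q))%N.
    apply: phi_min; split=> [//|E|E]; first by apply: pphi; rewrite -qE E zero_lfunE.
    by apply: kphi0; apply/eqP; rewrite -subv0 -E.
  move: (limg_ker_dim phi fullv) (limg_ker_dim q fullv); rewrite !capfv -/K.
  by move: (\dim K) (\dim (lker q)) => *; lia.
have [s sP hs] : exists2 s : I -> 'End(V),
    forall c, (forall v, s c v \in K) /\ (forall v, v \in K -> s c v = v) &
    forall i v, v \in rep_sub X i -> s (kappa i) v \in rep_sub X i.
  have /choice[s sP] c : exists s : 'End(V),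
      ((forall v, s v \in K) /\ (forall v, v \in K -> s v = v)) /\
      forall i v, kappa i = c -> v \in rep_sub X i -> s v \in rep_sub X i.
    by have [s s1 s2] := retraction K c; exists s.
  by exists s => [c|i v]; [case: (sP c) | case: (sP (kappa i)) => _; apply].
(* [r0] extends [p] from [K] to the whole space with no regard to the subspaces. It agrees with each
   [p \o s c] on [K], the kernel of [q], so the difference factors through [q]; the generalized
   inverse of [q] gives the factor [g c]. *)
pose r0 := (p \o projv K)%VF.
have r0E v : r0 v = p (projv K v) by rewrite /r0 comp_lfunE.
have r0K' v : r0 v \in K' by rewrite r0E p_img // memv_proj.
pose g c := ((p \o s c - r0) \o q^-1)%VF.
have [f fK' fP] : exists2 f : 'End(V), forall v, f v \in K' &
    forall i v, v \in K' -> v \in rep_sub X i -> f v - g (kappa i) v \in rep_sub X i.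
  apply: subrep_rigid => // c v.
  rewrite /g comp_lfunE add_lfunE opp_lfunE comp_lfunE rpredB // p_img //.
  by have [] := sP c.
have gq c v : g c (q v) = p (s c v) - r0 v.
  rewrite /g comp_lfunE add_lfunE opp_lfunE comp_lfunE.
  set v' := (q^-1)%VF (q v).
  have : v' - v \in K.
    apply: kq; rewrite memv_ker linearB subr_eq0 /=; apply/eqP.
    by have /lfunP/(_ v) := inv_lfun_def q; rewrite comp_lfunE [X in X = _ -> _]comp_lfunE.
  have [_ sK] := sP c => vK.
  have -> : v' = (v' - v) + v by rewrite subrK.
  move: (v' - v) vK => u uK.
  rewrite (linearD (s c)) (linearD r0) /= (sK u uK) (r0E u) (projv_id uK).
  by rewrite linearD /= addrC opprD addrACA addNr add0r addrC.
(* On [rep_sub X i] the map [r] is the sum of [f q - g q] and [p s], both of which stay in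
   [rep_sub X i]. So [r] is an idempotent endomorphism of [X] onto [K'], and it is neither 0 nor
   1. *)
pose r := (r0 + (f \o q))%VF.
have rE v : r v = r0 v + f (q v) by rewrite /r add_lfunE comp_lfunE.
have rK v : v \in K -> r v = p v.
  by move=> vK; rewrite rE r0E projv_id // qE (eqP (_ : phi v == 0)) -?memv_ker // !linear0 addr0.
have rK' v : r v \in K' by rewrite rE rpredD.
case: (indecomposable_idempotent (e := r) indecX).
- move=> i v vi; have -> : r v = (f (q v) - g (kappa i) (q v)) + p (s (kappa i) v).
    by rewrite rE gq opprB addrA subrK addrC.
  apply: rpredD; first by apply: fP => //; apply: hq.
  by apply: ph; [case: (sP (kappa i)) | apply: hs].
- by move=> v; rewrite rK ?pK' // K'K.
- by move=> /lfunP E; apply: pphi; rewrite -rK // E zero_lfunE.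
- move=> /lfunP E; apply: phi0; apply/lfunP => v; rewrite zero_lfunE; apply/eqP.
  by rewrite -memv_ker; apply: K'K; rewrite -(id_lfunE v) -E.
Qed.

End NotBrick.

Lemma not_brick_not_rigid_sub X : linrep_indecomposable X -> ~ brick X ->
  exists Y : linrep F T, [/\ linrep_indecomposable Y, ~ rigid kappa Y &
    (\dim {: rep_space Y} < \dim {: rep_space X})%N].
Proof.
move=> indX nb.
have [f hf nscal] : exists2 f : 'End(rep_space X), linrep_hom (X := X) (Y := X) f &
    forall a, f <> a *: \1%VF.
  apply: contrapT => H; apply: nb => f hf; apply: contrapT => H'; apply: H.
  by exists f => // a fa; apply: H'; exists a.
have V0 : \dim {: rep_space X} != 0%N.
  apply: contra_notN (nscal 0); rewrite dimv_eq0 => /eqP V0; apply/lfunP => v.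
  rewrite scale0r zero_lfunE; have := memvf v; rewrite V0 memv0 => /eqP->.
  exact: linear0.
(* Subtracting an eigenvalue from a non-scalar [f] leaves a nonzero endomorphism with nonzero
   kernel. *)
have [a fa] := closed_eigenvector f V0.
have : exists phi, singular_endo (X := X) phi.
  exists (f - a *: \1%VF); split; last exact/eqP.
    move=> i v vi; rewrite add_lfunE opp_lfunE scale_lfunE id_lfunE rpredB ?hf //.
    exact: rpredZ.
  by move/subr0_eq; apply: nscal.
case/(exists_minimal (fun phi => \dim (limg phi))) => phi phiS phi_min.
have sq0 := minimal_singular_square0 indX phiS phi_min.
have : exists p, kernel_idempotent (X := X) phi p.
  exists \1%VF; split=> [v|v|i v _|]; rewrite ?id_lfunE //.
  apply: contrapT => H; have [_ + _] := phiS; apply; apply/lfunP => v.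
  rewrite zero_lfunE; apply: contrapT => H'; apply: H.
  by exists v; rewrite id_lfunE.
case/(exists_minimal (fun p => \dim (p @: lker phi))) => p pP p_min.
exists (subrep (p @: lker phi)%VS); split.
- exact: kernel_summand_indecomposable.
- exact: kernel_summand_not_rigid.
- exact: kernel_summand_dim.
Qed.

End Ringel.

(** * The Euler form of a sum of chains and stability *)

Section KernelCounts.
Variables (F : fieldType) (E E' : vectType F) (S : finType) (rho : S -> 'Hom(E, E')).

Lemma dim_bigcap_ker_ge :
  (\dim {: E} <= \dim (\bigcap_s lker (rho s)) + \sum_s \dim (limg (rho s)))%N.
Proof.
elim: (index_enum S) => [|s r IH]; first by rewrite !big_nil addn0.
rewrite !big_cons; apply: (leq_trans IH).
rewrite -(limg_ker_dim (rho s) (\bigcap_(s <- r) lker (rho s))) capvC.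
by rewrite -addnA leq_add2l leq_add2r dimvS // limgS // subvf.
Qed.

(** The hypothesis says that the joint map from [E] to the product of the images of the [rho s] is
    onto. *)
Lemma dim_bigcap_ker_le :
  (forall s f, exists2 f', rho s f' = rho s f & forall s', s' != s -> rho s' f' = 0) ->
  (\dim (\bigcap_s lker (rho s)) + \sum_s \dim (limg (rho s)) <= \dim {: E})%N.
Proof.
move=> indep; elim: (index_enum S) (index_enum_uniq S) => [|s r IH] /=.
  by rewrite !big_nil addn0.
case/andP=> sr /IH{}IH; rewrite !big_cons; apply: leq_trans IH.
rewrite -[X in (_ <= X + _)%N](limg_ker_dim (rho s) (\bigcap_(s <- r) lker (rho s))) capvC.
rewrite -addnA leq_add2l leq_add2r dimvS //; apply/subvP => _ /memv_imgP[f _ ->].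
have [f' <- f'0] := indep s f; apply: memv_img.
elim: r sr => [|s' r IH]; first by rewrite big_nil memvf.
rewrite inE negb_or big_cons memv_cap memv_ker => /andP[ss' /IH->].
by rewrite f'0 ?eqxx // eq_sym.
Qed.

End KernelCounts.

Section AdaptedBasis.
Variables (F : fieldType) (V : vectType F) (U : nat -> {vspace V}).
Hypothesis U0 : U 0%N = 0%VS.
Hypothesis Umono : forall j, (U j <= U j.+1)%VS.

Lemma flag_le i j : (i <= j)%N -> (U i <= U j)%VS.
Proof.
elim: j => [|j IH]; first by rewrite leqn0 => /eqP->.
by rewrite leq_eqVlt => /predU1P[->//|/IH/subv_trans]; apply.
Qed.

Lemma adapted_basis n : exists2 e : seq V, basis_of (U n) e &
  forall j, (j <= n)%N -> basis_of (U j) [seq v <- e | v \in U j].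
Proof.
elim: n => [|n [e eB eU]].
  exists [::]; first by rewrite U0 nil_basis.
  by move=> j; rewrite leqn0 => /eqP->; rewrite U0 nil_basis.
pose C := (U n.+1 :\: U n)%VS.
have CU : (C :&: U n = 0)%VS by apply: capv_diff.
have UC : (U n + C = U n.+1)%VS.
  by rewrite addvC addv_diff; apply/addv_idPl.
have eCB : basis_of (U n.+1) (e ++ vbasis C).
  by rewrite -UC; apply: cat_basis (vbasisP C) => //; apply/directv_addP; rewrite capvC.
exists (e ++ vbasis C) => // j; rewrite leq_eqVlt ltnS => /predU1P[->|jn].
  by rewrite (all_filterP _) //; apply/allP => v; apply: basis_mem.
rewrite filter_cat (_ : [seq v <- vbasis C | _] = [::]) ?cats0 ?eU //.
apply/eqP; rewrite -size_eq0 size_filter -leqn0 leqNgt -has_count; apply/hasP => -[v vC vj].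
have /basis_not0 := vbasisP C; move=> /(_ v vC)/eqP; apply; apply/eqP.
by rewrite -memv0 -CU memv_cap vbasis_mem // (subvP (flag_le jn)).
Qed.

End AdaptedBasis.

Section PrimitivePoset.
Variables (d : Order.disp_t) (T : finPOrderType d).
Variables (m : nat) (k : 'I_m -> nat) (h : T -> {i : 'I_m & 'I_(k i)}).
Variable h' : {i : 'I_m & 'I_(k i)} -> T.
Hypothesis hK : cancel h h'.
Hypothesis h'K : cancel h' h.
Hypothesis hle : forall x y : T, (x <= y)%O = chain_sum_le (h x) (h y).

Definition arm (i : T) : 'I_m := tag (h i).
Definition height (i : T) : nat := tagged (h i).

Lemma arm_lt i j : (i < j)%O -> arm i = arm j.
Proof. by move/ltW; rewrite hle => /andP[/eqP]. Qed.

Section Flags.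
Variables (F : fieldType) (X : linrep F T).

(** The arm is completed by 0 below and by the whole space above, so an element of height [j] sits
    at position [j.+1] and always has two neighbours. *)
Definition flag (c : 'I_m) (j : nat) : {vspace rep_space X} :=
  if j is j'.+1 then
    if insub j' is Some o then rep_sub X (h' (Tagged (fun c => 'I_(k c)) (o : 'I_(k c))))
    else fullv
  else 0%VS.

Lemma flag0 c : flag c 0 = 0%VS. Proof. by []. Qed.

Lemma flag_full c : flag c (k c).+1 = fullv.
Proof. by rewrite /flag insubF ?ltnn. Qed.

Lemma flag_arm i : flag (arm i) (height i).+1 = rep_sub X i.
Proof.
rewrite /flag /height /arm -[in RHS](hK i); case: (h i) => c o /=.
by rewrite insubT //= => lt; congr (rep_sub X (h' (Tagged _ _))); apply: val_inj.
Qed.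

Lemma flag_mono c j : (flag c j <= flag c j.+1)%VS.
Proof.
case: j => [|j]; first exact: sub0v.
rewrite /flag; case: (insubP _ j.+1) => [o1 jk o1E|_]; last exact: subvf.
case: insubP => [o0 _ o0E|]; last by rewrite (ltn_trans (ltnSn j)).
have le : (h' (Tagged (fun c => 'I_(k c)) o0) <= h' (Tagged (fun c => 'I_(k c)) o1))%O.
  rewrite hle !h'K /chain_sum_le /= eqxx /=.
  by move: o0E o1E => /= -> ->.
by move: le; rewrite le_eqVlt => /predU1P[->//|]; apply: rep_sub_mono.
Qed.

Lemma arm_retraction (K : {vspace rep_space X}) c :
  exists2 s : 'End(rep_space X), (forall v, s v \in K) /\ (forall v, v \in K -> s v = v) &
    forall i v, arm i = c -> v \in rep_sub X i -> s v \in rep_sub X i.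
Proof.
have [s sP] := flag_retraction K (k c).+1 (flag_mono c).
exists s => [|i v ic].
  have [sU sK] := sP _ (leqnn _); rewrite flag_full in sU sK.
  split=> [v|v vK]; last by apply: sK; rewrite memv_cap memvf.
  by have := sU v (memvf v); rewrite memv_cap => /andP[].
rewrite -flag_arm ic => vi; have [|sU _] := sP (height i).+1.
  by rewrite ltnW // ltnS -ic; apply: ltn_ord.
by have := sU v vi; rewrite memv_cap => /andP[].
Qed.

End Flags.
Arguments flag {F} X c j : simpl never.

(** Induction on the dimension: an indecomposable which is not a brick would contain a smaller
    indecomposable that is not rigid. *)
Lemma finite_type_rigid (F : closedFieldType) (X : linrep F T) :
  finite_rep_type F T -> linrep_indecomposable X -> brick X /\ rigid arm X.
Proof.
move=> ft; have ringel := not_brick_not_rigid_sub (@arm_retraction F).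
have rig (Y : linrep F T) : linrep_indecomposable Y -> rigid arm Y.
  move: {2}(\dim {: rep_space Y}).+1 (ltnSn (\dim {: rep_space Y})) => n.
  elim: n Y => // n IH Y; rewrite ltnS => Yn indY.
  have [bY|nbY] := pselect (brick Y); first exact: (finite_type_brick_rigid arm_lt ft).
  have [Z [indZ nrigZ dimZ]] := ringel Y indY nbY.
  by case: nrigZ; apply: IH => //; apply: leq_trans dimZ Yn.
move=> indX; split; last exact: rig.
by apply: contrapT => /(ringel X indX)[Z [indZ nrigZ _]]; apply/nrigZ/rig.
Qed.

Section HomCount.
Variables (F : fieldType) (X Y : linrep F T).
Let V := rep_space X.
Let W := rep_space Y.

(** The negative part of the Euler form, which is [\dim {: V} * \dim {: W} - arms_pairing]. The
    summand of [c] is the codimension in ['Hom(V, W)] of the maps that respect the two flags of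
    [c]. *)
Definition arms_pairing : nat :=
  (\sum_c \sum_(j < (k c).+1)
     \dim (flag X c j) * (\dim (flag Y c j.+1) - \dim (flag Y c j)))%N.

Lemma arm_basis c : exists2 e : (\dim {: V}).-tuple V, basis_of {: V} e &
  forall j, (j <= (k c).+1)%N -> basis_of (flag X c j) [seq v <- e | v \in flag X c j].
Proof.
have [e eB eU] := adapted_basis (flag0 X c) (flag_mono X c) (k c).+1.
rewrite flag_full in eB.
have se : size e == \dim {: V} by rewrite (size_basis (X := in_tuple e)).
by exists (Tuple se).
Qed.

(* Hom(X, Y) and Ext^1(X, Y) are the kernel and the cokernel of the map from
   Hom(V, W) to the product over the arms c of the quotients
   Hom(V, W) / {f | f maps the flag of X in c to that of Y}; a basis of V adapted
   to the flag computes the dimension of each quotient. *)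
Lemma hom_count :
  ((forall f, linrep_hom (X := X) (Y := Y) f -> f = 0) ->
     (\dim {: V} * \dim {: W} <= arms_pairing)%N) /\
  ((forall g : 'I_m -> 'Hom(V, W), exists f : 'Hom(V, W),
      forall i v, v \in rep_sub X i -> f v - g (arm i) v \in rep_sub Y i) ->
   (exists2 f, linrep_hom (X := X) (Y := Y) f & f <> 0) ->
     (arms_pairing < \dim {: V} * \dim {: W})%N).
Proof.
have /choice[e eP] c : exists e : (\dim {: V}).-tuple V, basis_of {: V} e /\
  forall j, (j <= (k c).+1)%N -> basis_of (flag X c j) [seq v <- e | v \in flag X c j].
  by have [e e1 e2] := arm_basis c; exists e.
have eB c := proj1 (eP c); have eU c := proj2 (eP c).
have /choice[lev levP] (s : 'I_m * 'I_(\dim {: V})) : exists l : nat,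
    (l <= (k s.1).+1)%N /\
    forall j, ((e s.1)`_s.2 \in flag X s.1 j) = (l <= j)%N.
  have ex : exists j, (e s.1)`_s.2 \in flag X s.1 j.
    by exists (k s.1).+1; rewrite flag_full memvf.
  case: (ex_minnP ex) => l lP lmin; exists l.
  split; first by apply: lmin; rewrite flag_full memvf.
  move=> j; apply/idP/idP; first exact: lmin.
  by move=> lj; apply: subvP lP; apply: flag_le => //; apply: flag_mono.
pose WS s := flag Y s.1 (lev s).
(* The kernel of [q s] is [WS s], so its image stands for the quotient of [W] by [WS s]: a map
   respects the flags of an arm exactly when [q s] kills its value at each vector of the adapted
   basis. *)
pose q s : 'End(W) := \1%VF - projv (WS s).
have qE s w : q s w = w - projv (WS s) w.
  by rewrite /q add_lfunE opp_lfunE id_lfunE.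
have q0 s w : (q s w == 0) = (w \in WS s).
  rewrite qE subr_eq0; apply/eqP/idP => [->|/projv_id//].
  exact: memv_proj.
pose rho s : 'Hom('Hom(V, W), W) := linfun (fun f : 'Hom(V, W) => q s (f (e s.1)`_s.2)).
have rhoE s f : rho s f = q s (f (e s.1)`_s.2).
  rewrite /rho linfun_linear // => a u v.
  by rewrite /= -linearP; congr (q s _); rewrite add_lfunE scale_lfunE.
have mapb c (b : 'I_(\dim {: V})) w : exists f : 'Hom(V, W),
    forall b' : 'I_(\dim {: V}), f (e c)`_b' = (b == b')%:R *: w.
  exists (linfun (fun v => coord (e c) b v *: w)) => b'.
  rewrite linfun_linear ?(coord_free _ _ (basis_free (eB c))) ?[b' == b]eq_sym //.
  by move=> a u v; rewrite linearP scalerDl scalerA.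
have limgrho s : \dim (limg (rho s)) = (\dim {: W} - \dim (WS s))%N.
  have -> : limg (rho s) = limg (q s).
    apply/vspaceP => w; apply/memv_imgP/memv_imgP => [[f _ ->]|[w' _ ->]].
      by exists (f (e s.1)`_s.2); rewrite ?memvf ?rhoE.
    have [f fE] := mapb s.1 s.2 w'; exists f; rewrite ?memvf // rhoE fE eqxx.
    by rewrite scale1r.
  rewrite -(limg_ker_dim (q s) fullv) capfv (_ : lker (q s) = WS s) ?addKn //.
  by apply/vspaceP => w; rewrite memv_ker q0.
have sumrho : (\sum_s \dim (limg (rho s)) = arms_pairing)%N.
  under eq_bigr do rewrite limgrho.
  transitivity (\sum_c \sum_(b < \dim {: V}) (\dim {: W} - \dim (WS (c, b))))%N.
    by rewrite pair_bigA; apply: eq_bigr => -[].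
  apply: eq_bigr => c _.
  have dX j : (j <= (k c).+1)%N -> \dim (flag X c j) =
      (\sum_(b < \dim {: V}) (lev (c, b) <= j))%N.
    move=> jk; rewrite (size_basis (X := in_tuple _) (eU c j jk)) size_filter.
    rewrite -sum1_count big_mkcond /= (big_nth 0) big_mkord size_tuple.
    by apply: eq_bigr => b _; have [_ ->] := levP (c, b); case: leqP.
  under [RHS]eq_bigr => j _ do rewrite dX ?(ltnW (ltn_ord j)) // big_distrl /=.
  rewrite exchange_big /=; apply: eq_bigr => b _.
  have [lk _] := levP (c, b); rewrite /= in lk.
  rewrite -(big_mkord xpredT (fun j => (lev (c, b) <= j) *
     (\dim (flag Y c j.+1) - \dim (flag Y c j)))%N) /= (big_cat_nat (leq0n _) lk) /=.
  rewrite big_nat big1 ?add0n => [|j /andP[_ jl]]; last by rewrite leqNgt jl mul0n.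
  under eq_big_nat => j /andP[lj _] do rewrite lj mul1n.
  rewrite telescope_sumn => [|i j ij]; first by rewrite flag_full.
  by apply: dimvS; apply: flag_le => //; apply: flag_mono.
have mem_ker f : (f \in (\bigcap_s lker (rho s))%VS) <-> linrep_hom (X := X) (Y := Y) f.
  have -> : (f \in (\bigcap_s lker (rho s))%VS) =
      [forall s : 'I_m * 'I_(\dim {: V}), f (e s.1)`_s.2 \in WS s].
    rewrite memvE; apply/subv_bigcapP/forallP => H s; have := H s.
      by rewrite -memvE memv_ker rhoE q0 => ->.
    by move=> fs _; rewrite -memvE memv_ker rhoE q0.
  split=> [/forallP fs i|hf]; last first.
    apply/forallP => s; rewrite /WS.
    have : (e s.1)`_s.2 \in flag X s.1 (lev s) by have [_ ->] := levP s.
    move: (flag_full Y s.1); rewrite /flag; case: (lev s) => [|l].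
      by rewrite !memv0 => _ /eqP->; rewrite linear0.
    by move=> _; case: insubP => [o _ _|_ _]; [apply: hf | rewrite memvf].
  have : (flag X (arm i) (height i).+1 <= f @^-1: flag Y (arm i) (height i).+1)%VS.
    have hk : ((height i).+1 <= (k (arm i)).+1)%N by apply/ltnW/ltn_ord.
    rewrite -{1}(span_basis (eU _ _ hk)); apply/span_subvP => v.
    rewrite mem_filter -memv_preim => /andP[+ /(nthP 0)[b]].
    rewrite size_tuple => + be bv; rewrite -{}bv.
    have [_ /(_ (height i).+1) /= ->] := levP (arm i, Ordinal be).
    move=> lb; have := fs (arm i, Ordinal be); apply: subvP.
    exact: (flag_le (flag_mono Y (arm i)) lb).
  by rewrite !flag_arm => /subvP sub v /sub; rewrite -memv_preim.
have dimE : \dim {: 'Hom(V, W)} = (\dim {: V} * \dim {: W})%N by rewrite !dimvf.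
split=> [hom0|rig [f hf f0]].
  have := dim_bigcap_ker_ge rho; rewrite sumrho dimE.
  rewrite (_ : (\bigcap_s _)%VS = 0%VS) ?dimv0 //.
  by apply/eqP; rewrite -subv0; apply/subvP => f /mem_ker/hom0->; rewrite mem0v.
have /dim_bigcap_ker_le : forall s f, exists2 f', rho s f' = rho s f &
    forall s', s' != s -> rho s' f' = 0.
  (* The cochain is concentrated in the arm [c], where it is a map [g0] agreeing with [f1] at the
     basis vector [b] and vanishing at the others; [f'] is congruent to it in every arm. *)
  move=> [c b] f1; have [g0 g0E] := mapb c b (f1 (e c)`_b).
  have [f' f'P] := rig (fun c' => (c' == c)%:R *: g0).
  have f'F c' : forall j v, v \in flag X c' j ->
      f' v - ((c' == c)%:R *: g0) v \in flag Y c' j.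
    case=> [|j] v; first by rewrite memv0 => /eqP->; rewrite !linear0 addr0 mem0v.
    rewrite /flag; case: insubP => [o _ _|_ _]; last exact: memvf.
    by move/f'P; rewrite /arm h'K.
  have rhof' c' (b' : 'I_(\dim {: V})) : rho (c', b') f' =
      q (c', b') (((c' == c)%:R *: g0) (e c')`_b').
    apply/eqP; rewrite rhoE -subr_eq0 -linearB /= q0; apply: f'F.
    by have [_ ->] := levP (c', b').
  exists f' => [|[c' b'] nb]; rewrite rhof' scale_lfunE.
    by rewrite eqxx rhoE /= g0E eqxx !scale1r.
  case: (c' =P c) nb => [->|_ _]; last by rewrite mulr0n scale0r linear0.
  by rewrite xpair_eqE eqxx /= g0E eq_sym => /negPf->; rewrite mulr0n scale0r scaler0 linear0.
rewrite sumrho dimE; apply: leq_trans; rewrite -add1n leq_add2r lt0n dimv_eq0.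
apply: contra_notN f0 => /eqP K0; apply/eqP; rewrite -memv0 -K0; exact/mem_ker.
Qed.

End HomCount.

Lemma sum_arms (G : 'I_m -> nat -> nat) :
  (\sum_i G (arm i) (height i) = \sum_c \sum_(j < k c) G c j)%N.
Proof.
rewrite (reindex h') /=; last by exists h => x _; [exact: h'K | exact: hK].
rewrite sig_big_dep /=; apply: eq_bigr => s _.
by rewrite /arm /height h'K.
Qed.

(** Summation by parts in the natural numbers. With [n] the length of an arm, [y n.+1] is the full
    dimension and the boundary term contributes to the slope. *)
Lemma abel_pairing (x y : nat -> nat) n : x 0 = 0%N -> y 0 = 0%N ->
  (forall j, x j <= x j.+1)%N -> (forall j, y j <= y j.+1)%N ->
  (\sum_(j < n.+1) y j * (x j.+1 - x j) + x n * y n.+1 =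
   \sum_(j < n.+1) x j * (y j.+1 - y j) + \sum_(j < n) (x j.+2 - x j) * y j.+1)%N.
Proof.
move=> x0 y0 xm ym; elim: n => [|n IH]; first by rewrite !big_ord_recl !big_ord0 /= x0 y0.
have recr (G : nat -> nat) p : (\sum_(j < p.+1) G j = \sum_(j < p) G j + G p)%N.
  by rewrite big_ord_recr.
rewrite (recr (fun j => y j * (x j.+1 - x j))%N) (recr (fun j => x j * (y j.+1 - y j))%N).
rewrite (recr (fun j => (x j.+2 - x j) * y j.+1)%N).
have [a xa] : exists a, x n.+1 = (x n + a)%N by exists (x n.+1 - x n)%N; rewrite subnKC.
have [b xb] : exists b, x n.+2 = (x n.+1 + b)%N by exists (x n.+2 - x n.+1)%N; rewrite subnKC.
have [e ye] : exists e, y n.+2 = (y n.+1 + e)%N by exists (y n.+2 - y n.+1)%N; rewrite subnKC.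
have -> : (x n.+2 - x n.+1 = b)%N by lia.
have -> : (x n.+2 - x n = a + b)%N by lia.
have -> : (y n.+2 - y n.+1 = e)%N by lia.
move: IH; rewrite ye xa; set A := (\sum_(i < _) _)%N; set B := (\sum_(i < _) _)%N.
set C := (\sum_(i < _) _)%N; nia.
Qed.

Lemma dim_flag_mono (F : fieldType) (X : linrep F T) c j :
  (\dim (flag X c j) <= \dim (flag X c j.+1))%N.
Proof. exact/dimvS/flag_mono. Qed.

Section Stability.
Variables (F : fieldType) (X : linrep F T).
Let V := rep_space X.
Let N := \dim {: V}.

Definition canonical_weight (i : T) : nat :=
  \dim (flag X (arm i) (height i).+2) - \dim (flag X (arm i) (height i)).

Definition canonical_slope : nat := \sum_c \dim (flag X c (k c)).

(** The defect of [Y] for the canonical weight, slope times dimension minus weighted dimensions, is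
    [<Y, X> - <X, Y>], the antisymmetrized Euler form. Hence it vanishes at [Y] = [X]. *)
Lemma canonical_weight_pairing (Y : linrep F T) :
  (arms_pairing Y X + canonical_slope * \dim {: rep_space Y} =
   arms_pairing X Y + \sum_i canonical_weight i * \dim (rep_sub Y i))%N.
Proof.
under [X in (_ = _ + X)%N]eq_bigr => i _ do rewrite -(flag_arm Y).
rewrite (sum_arms (fun c j => (\dim (flag X c j.+2) - \dim (flag X c j)) *
  \dim (flag Y c j.+1))%N).
rewrite /canonical_slope big_distrl /= -!big_split /=; apply: eq_bigr => c _.
rewrite -(flag_full Y c).
by apply: (abel_pairing (x := fun j => \dim (flag X c j)) (y := fun j => \dim (flag Y c j)));
  rewrite ?dimv0 // => j; apply: dim_flag_mono.
Qed.

Lemma dim_rep_sub_subrep (U : {vspace V}) i :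
  \dim (rep_sub (subrep U) i) = \dim (rep_sub X i :&: U).
Proof.
have k0 : lker (linfun (@vsval _ _ U)) == 0%VS.
  by apply/lker0P => x y; rewrite !lfunE => /val_inj.
rewrite -(limg_dim_eq (f := linfun (@vsval _ _ U))); last first.
  by rewrite (eqP k0) capv0.
congr (\dim _); apply/vspaceP => v; rewrite memv_cap.
apply/memv_imgP/andP => [[w + ->]|[vi vU]].
  by rewrite mem_subrep lfunE subvsP.
by exists (vsproj U v); rewrite ?mem_subrep ?lfunE /= vsprojK.
Qed.

Hypothesis brickX : brick X.
Hypothesis rigidX : rigid arm X.

Lemma canonical_weight_balanced :
  (\sum_i canonical_weight i * \dim (rep_sub X i) = canonical_slope * N)%N.
Proof. exact/esym/(addnI (canonical_weight_pairing X)). Qed.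

(** A morphism from [X] to [U], followed by the inclusion, is a scalar because [X] is a brick, and
    this scalar is 0 because [U] is proper. A cochain from [U] to [X] extends to [X] along a linear
    projection onto [U], where rigidity of [X] splits it. *)
Lemma canonical_weight_stable (U : {vspace V}) : (0 < \dim U < N)%N ->
  (\sum_i canonical_weight i * \dim (rep_sub X i :&: U) < canonical_slope * \dim U)%N.
Proof.
case/andP=> U0 UN; pose Y := subrep U.
have [_ lt] := hom_count Y X; have [le _] := hom_count X Y.
have YX : (arms_pairing Y X < \dim U * N)%N.
  rewrite -[X in (_ < X * _)%N](dim_subvs U); apply: lt => [g|].
    have [f fP] := rigidX (fun c => g c \o linfun (vsproj U))%VF.
    exists (f \o linfun (@vsval _ _ U))%VF => i w; rewrite mem_subrep => /fP.
    by rewrite !comp_lfunE !lfunE /= vsvalK.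
  exists (linfun (@vsval _ _ U)) => [i w|E]; first by rewrite mem_subrep lfunE.
  move: U0; rewrite lt0n dimv_eq0 => /eqP; apply; apply/eqP; rewrite -subv0.
  apply/subvP => v vU; have := lfunE (@vsval _ _ U) (vsproj U v).
  by rewrite E zero_lfunE /= vsprojK // => <-; rewrite mem0v.
have XY : (N * \dim U <= arms_pairing X Y)%N.
  rewrite -[X in (_ * X <= _)%N](dim_subvs U); apply: le => f hf.
  have fE v : (linfun (@vsval _ _ U) \o f)%VF v = vsval (f v) by rewrite comp_lfunE lfunE.
  have [|a aE] := brickX (f := (linfun (@vsval _ _ U) \o f)%VF).
    by move=> i v /hf; rewrite mem_subrep fE.
  have {}aE v : vsval (f v) = a *: v by rewrite -fE aE scale_lfunE id_lfunE.
  have [a0|a0] := eqVneq a 0.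
    by apply/lfunP => v; apply: val_inj; rewrite /= aE a0 scale0r zero_lfunE.
  move: UN; rewrite ltnNge => /negP[]; apply/dimvS/subvP => v _.
  by rewrite -(scalerK a0 v) memvZ // -aE subvsP.
have := canonical_weight_pairing Y; rewrite dim_subvs.
under eq_bigr => i _ do rewrite dim_rep_sub_subrep.
move=> E; rewrite -(ltn_add2l (arms_pairing X Y)) -E ltn_add2r.
by apply: leq_trans YX _; rewrite mulnC.
Qed.

Lemma positive_stable_weight : exists (a : T -> nat) (g : nat),
  [/\ forall i, (0 < a i)%N, (\sum_i a i * \dim (rep_sub X i) = g * N)%N &
    forall U : {vspace V}, (0 < \dim U < N)%N ->
      (\sum_i a i * \dim (rep_sub X i :&: U) < g * \dim U)%N].
Proof.
have [N0|N0] := posnP N.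
  exists (fun=> 1%N), 0%N; split=> // [|U]; last by rewrite N0 ltn0 andbF.
  by rewrite mul0n big1 // => i _; apply/eqP; rewrite mul1n -leqn0 -N0 dimvS ?subvf.
pose S := (\sum_i \dim (rep_sub X i))%N; pose M := S.+1.
pose G (y : T -> nat) := (\sum_i canonical_weight i * y i)%N.
have sumE (y : T -> nat) : (\sum_i N * (M * canonical_weight i).+1 * y i =
    N * (M * G y + \sum_i y i))%N.
  rewrite /G mulnDr !big_distrr -big_split /=; apply: eq_bigr => i _.
  by rewrite -mulnA mulSn mulnDr addnC !mulnA.
(* Each weight is multiplied by [M] and increased by 1. Balance then requires the slope
   [M * canonical_slope + S / N], whose denominator is cleared by [N]. The canonical defect of a
   proper [U] is at least 1, and [M] = [S] + 1 times it exceeds the increase, which is at most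
   [S]. *)
exists (fun i => N * (M * canonical_weight i).+1)%N, (M * canonical_slope * N + S)%N; split.
- by move=> i; rewrite muln_gt0 N0.
- by rewrite sumE /G canonical_weight_balanced [RHS]mulnC !mulnA.
move=> U UN; rewrite sumE; have := canonical_weight_stable UN.
have : (\sum_i \dim (rep_sub X i :&: U) <= S)%N.
  by apply: leq_sum => i _; apply/dimvS/capvSl.
rewrite -/(G _); move: (G _) (\sum_i _)%N => g s sS gU.
have U0 : (0 < \dim U)%N by case/andP: UN.
have : (M * g + s < M * (canonical_slope * \dim U))%N.
  by rewrite /M; nia.
nia.
Qed.

End Stability.
End PrimitivePoset.

Section HermitianMatrices.
Local Open Scope sesquilinear_scope.
Local Open Scope complex_scope.

(** * Gram determinants and their first variation *)

Section CauchyBinet.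
Variables (F : comNzRingType) (k n : nat) (A : 'M[F]_(k, n)) (B : 'M[F]_(n, k)).

Let det_mulmx_rows :
  \det (A *m B) = \sum_(f : {ffun 'I_k -> 'I_n}) (\prod_a A a (f a)) * \det (rowsub f B).
Proof.
under [RHS]eq_bigr => f _ do rewrite big_distrr /=.
rewrite exchange_big /=; apply: eq_bigr => s _.
under eq_bigr => a _ do rewrite mxE.
rewrite bigA_distr_bigA big_distrr /=; apply: eq_bigr => f _.
rewrite big_split /= mulrCA; congr (_ * (_ * _)).
by apply: eq_bigr => a _; rewrite mxE.
Qed.

(** Cauchy-Binet with the sum over all maps instead of subsets: maps that are not injective
    contribute 0 and every subset is counted [k!] times. *)
Lemma det_mulmx_sum : k`!%:R * \det (A *m B) =
  \sum_(f : {ffun 'I_k -> 'I_n}) \det (colsub f A) * \det (rowsub f B).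
Proof.
have -> : k`!%:R * \det (A *m B) = \sum_(s : 'S_k) \det (A *m B).
  by rewrite sumr_const card_Sn mulr_natl.
transitivity (\sum_(s : 'S_k) \sum_(f : {ffun 'I_k -> 'I_n})
    (\prod_a A a (f (s a))) * ((-1) ^+ s * \det (rowsub f B))).
  apply: eq_bigr => s _; rewrite det_mulmx_rows.
  pose cs (p : 'S_k) (f : {ffun 'I_k -> 'I_n}) := [ffun a => f (p a)].
  rewrite (reindex (cs s)); last first.
    by exists (cs s^-1)%g => f _; apply/ffunP => a; rewrite !ffunE ?permKV ?permK.
  apply: eq_bigr => f _; congr (_ * _); first by apply: eq_bigr => a _; rewrite ffunE.
  have -> : rowsub (cs s f) B = row_perm s (rowsub f B).
    by apply/matrixP => a b; rewrite !mxE ffunE.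
  by rewrite row_permE det_mulmx det_perm.
rewrite exchange_big /=; apply: eq_bigr => f _.
rewrite big_distrl /=; apply: eq_bigr => s _.
rewrite mulrCA mulrA; congr (_ * _ * _).
by apply: eq_bigr => a _; rewrite mxE.
Qed.

End CauchyBinet.

(** * Pivot columns of a matrix of full row rank *)

Section Pivots.
Variables (F : fieldType) (k n : nat) (M : 'M[F]_(k, n)).

Let N := M^T.
Let P (j : nat) : 'M[F]_k := (\sum_(s < n | (s < j)%N) <<row s N>>)%MS.
Let pivot (s : 'I_n) := ~~ (row s N <= P s)%MS.
Let Q (j : nat) : 'M[F]_k := (\sum_(s < n | pivot s && (s < j)%N) <<row s N>>)%MS.

Let P_rec (s : 'I_n) : (P s.+1 :=: P s + row s N)%MS.
Proof.
rewrite /P (bigD1 s) //= addsmxC; apply: (eqmx_trans (adds_eqmx _ (genmxE _))); last first.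
  exact: eqmx_refl.
suff -> : (\sum_(i < n | (i < s.+1)%N && (i != s)) <<row i N>> = P s)%MS by apply: eqmx_refl.
apply: eq_bigl => i; rewrite ltnS -val_eqE /=; lia.
Qed.

(** A column raises the rank of the span of its predecessors by one if it is a pivot and leaves the
    span unchanged otherwise. *)
Let P_rank j : (j <= n)%N ->
  (\rank (P j) = #|[set s | pivot s && (s < j)%N]|)%N /\ (P j <= Q j)%MS.
Proof.
elim: j => [_|j IH jn].
  rewrite /P big_pred0 // mxrank0 sub0mx; split=> //; apply/esym/eqP.
  by rewrite cards_eq0; apply/eqP/setP => s; rewrite !inE ltn0 andbF.
have [rk sub] := IH (ltnW jn); pose s := Ordinal jn.
have sv : s = j :> nat by [].
have PS := P_rec s; rewrite sv in PS.
have [sp|sp] := boolP (pivot s).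
- have -> : [set i | pivot i && (i < j.+1)%N] = s |: [set i | pivot i && (i < j)%N].
    apply/setP => i; rewrite !inE ltnS leq_eqVlt; have [->|] := eqVneq i s.
      by rewrite sp sv eqxx.
    by rewrite -val_eqE /= => /negPf->.
  rewrite cardsU1 inE sv ltnn andbF add1n -rk; split.
    apply/eqP; rewrite eqn_leq; apply/andP; split.
      rewrite PS (leq_trans (mxrank_adds_leqif _ _)) // -[X in (_ <= X)%N]addn1 leq_add2l.
      exact: rank_leq_row.
    have : (P j < P j.+1)%MS.
      rewrite /ltmx !PS addsmxSl /=; apply: contra sp => le.
      by apply: submx_trans le; apply: addsmxSr.
    by rewrite ltmxErank => /andP[].
  rewrite PS addsmx_sub; apply/andP; split.
    apply: (submx_trans sub); apply/sumsmx_subP => i /andP[ip ij].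
    by apply: (sumsmx_sup i); rewrite ?ip ?ltnS ?(ltnW ij).
  by apply: (sumsmx_sup s); rewrite ?genmxE ?sp //= ltnS.
have -> : [set i | pivot i && (i < j.+1)%N] = [set i | pivot i && (i < j)%N].
  by apply/setP => i; rewrite !inE ltnS leq_eqVlt; case: eqP => //= ij;
     rewrite (_ : i = s) ?(negPf sp) //; apply: val_inj.
have PSj : (P j.+1 :=: P j)%MS.
  by apply: (eqmx_trans PS); apply/addsmx_idPl; move: sp; rewrite negbK.
rewrite !PSj rk; split=> //; apply: (submx_trans sub); apply/sumsmx_subP => i /andP[ip ij].
by apply: (sumsmx_sup i); rewrite ?ip ?ltnS ?(ltnW ij).
Qed.

(* The pivot columns of the echelon form: those outside the span of the
   preceding columns. *)
Lemma pivot_columns : row_free M -> exists2 f : 'I_k -> 'I_n,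
  \det (colsub f M) != 0 &
  forall j, (j <= n)%N -> (\rank (M *m pid_mx j : 'M_(k, n)) <= #|[set a | (f a < j)%N]|)%N.
Proof.
move=> freeM; pose S := [set s | pivot s].
have [rkn subn] := P_rank (leqnn n).
have NP : (N <= P n)%MS.
  by apply/row_subP => s; apply: (sumsmx_sup s); rewrite ?genmxE.
have cardS : #|S| = k.
  have -> : S = [set s | pivot s && (s < n)%N].
    by apply/setP => s; rewrite !inE ltn_ord andbT.
  rewrite -rkn; apply/eqP; rewrite eqn_leq rank_leq_row /=.
  have := mxrankS NP; rewrite mxrank_tr; apply: leq_trans.
  by move: freeM; rewrite /row_free => /eqP->.
pose f a := enum_val (cast_ord (esym cardS) a).
have f_inj : injective f by move=> a b /enum_val_inj/cast_ord_inj.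
have f_on s : s \in S -> exists a, s = f a.
  move=> sS; exists (cast_ord cardS (enum_rank_in sS s)).
  by rewrite /f cast_ordK enum_rankK_in.
have fS a : f a \in S by apply: enum_valP.
exists f => [|j jn].
  rewrite -unitfE -unitmxE -unitmx_tr -row_full_unit -sub1mx.
  have : (1%:M <= N)%MS by rewrite sub1mx /row_full mxrank_tr.
  move/submx_trans; apply; apply: (submx_trans NP); apply: (submx_trans subn).
  apply/sumsmx_subP => s /andP[sp _]; have [|a ->] := f_on s; first by rewrite inE.
  rewrite genmxE (_ : row (f a) N = row a (colsub f M)^T) ?row_sub //.
  by apply/rowP => b; rewrite !mxE.
rewrite -mxrank_tr trmx_mul tr_pid_mx -/N.
have /mxrankS/leq_trans : ((pid_mx j : 'M_n) *m N <= P j)%MS.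
  apply/row_subP => s; rewrite row_mul.
  have -> : row s (pid_mx j : 'M[F]_n) = (s < j)%N%:R *: delta_mx 0 s.
    by apply/rowP => b; rewrite !mxE eqxx -val_eqE eq_sym; case: eqP; case: (s < j)%N;
       rewrite /= ?mulr1n ?mulr0n ?mulr0 ?mulr1.
  rewrite -scalemxAl -rowE; case: ltnP => sj; last by rewrite scale0r sub0mx.
  by rewrite scale1r; apply: (sumsmx_sup s); rewrite ?genmxE.
apply; have [-> _] := P_rank jn.
have <- : [set f a | a in [set a | (f a < j)%N]] = [set s | pivot s && (s < j)%N].
  apply/setP => s; rewrite inE; apply/imsetP/andP => [[a + ->]|[sp sj]].
    by rewrite inE; have := fS a; rewrite inE.
  by have [|a sa] := f_on s; [rewrite inE | exists a; rewrite // inE -sa].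
by rewrite card_imset.
Qed.

End Pivots.

(** * First variations as derivatives of polynomials at 0 *)

Section DerivativeAtZero.
Variable F : idomainType.
Implicit Types p q : {poly F}.

Definition deriv0 p : F := p^`().[0].

Lemma deriv0B p q : deriv0 (p - q) = deriv0 p - deriv0 q.
Proof. by rewrite /deriv0 derivB hornerD hornerN. Qed.

Lemma deriv0M p q : deriv0 (p * q) = deriv0 p * q.[0] + p.[0] * deriv0 q.
Proof. by rewrite /deriv0 derivM hornerD !hornerM. Qed.

Lemma deriv0_prod (I : finType) (p : I -> {poly F}) : (forall i, (p i).[0] = 1) ->
  deriv0 (\prod_i p i) = \sum_i deriv0 (p i).
Proof.
move=> p1; apply: proj2 (_ : (\prod_i p i).[0] = 1 /\ _).
elim/big_rec2: _ => [|i x q _ [q1 <-]]; first by rewrite hornerC /deriv0 derivC horner0.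
by rewrite hornerM p1 q1 mul1r deriv0M p1 q1 mulr1 mul1r.
Qed.

Lemma deriv0X p n : p.[0] = 1 -> deriv0 (p ^+ n) = deriv0 p *+ n.
Proof.
move=> p1; rewrite -[n in p ^+ n]card_ord -prodr_const deriv0_prod //.
by rewrite sumr_const card_ord.
Qed.

(** Jacobi's formula at the identity. A nontrivial permutation moves some [a] and hence also [s a],
    so its product has two factors vanishing at 0 and no linear term. *)
Lemma deriv0_det k (A : 'M[{poly F}]_k) :
  map_mx (horner_eval 0) A = 1%:M -> deriv0 (\det A) = \tr (map_mx deriv0 A).
Proof.
move=> /matrixP evA; have A1 a b : (A a b).[0] = (a == b)%:R by have := evA a b; rewrite !mxE.
rewrite /mxtrace; under [RHS]eq_bigr => a _ do rewrite mxE.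
have -> : deriv0 (\det A) = \sum_(s : 'S_k) (-1) ^+ s * deriv0 (\prod_a A a (s a)).
  rewrite /deriv0 /determinant raddf_sum horner_sum /=; apply: eq_bigr => s _.
  by rewrite !mulr_sign; case: ifP; rewrite // derivN hornerN.
rewrite (bigD1 1%g) //= odd_perm1 expr0 mul1r.
under eq_bigr => a _ do rewrite perm1.
rewrite deriv0_prod => [|a]; last by rewrite A1 eqxx.
rewrite [X in _ + X]big1 ?addr0 // => s s1.
have [a sa] : exists a, s a != a.
  apply/existsP; apply: contraNT s1; rewrite negb_exists => /forallP H.
  by apply/eqP/permP => a; rewrite perm1; apply/eqP; have := H a; rewrite negbK.
rewrite (bigD1 a) //= (bigD1 (s a)) //= mulrA deriv0M deriv0M !hornerM !A1.
have ssa : s a == s (s a) = false.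
  by rewrite (inj_eq perm_inj) eq_sym (negPf sa).
by rewrite (eq_sym a) (negPf sa) ssa /= !mulr0n !(mulr0, mul0r, addr0).
Qed.

End DerivativeAtZero.

Lemma deriv0_eq0 (C : numClosedFieldType) (p : {poly C}) :
  (forall t, t \is Num.real -> 0 <= p.[t]) -> p.[0] = 0 -> deriv0 p = 0.
Proof.
move=> p_ge0 p0; have /factor_theorem[q pE] : root p 0 by apply/eqP.
rewrite subr0 in pE.
have /factor_theorem[s qE] : root (q - q.[0]%:P) 0.
  by rewrite /root hornerD hornerN hornerC subrr.
rewrite subr0 in qE; have {}qE : q = q.[0]%:P + s * 'X by rewrite -qE addrC subrK.
have pt t : p.[t] = (q.[0] + s.[t] * t) * t.
  by rewrite pE hornerM hornerX {1}qE hornerD hornerC hornerM hornerX.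
have -> : deriv0 p = q.[0].
  by rewrite pE deriv0M hornerX mulr0 add0r /deriv0 derivX hornerC mulr1.
have [M sM] := poly_disk_bound s 1.
have M0 : 0 <= M by apply: le_trans (sM 0 _); rewrite ?normr0.
apply/eqP/negPn/negP => c0; pose c := `|q.[0]|.
have c_gt0 : 0 < c by rewrite normr_gt0.
have d_gt0 : 0 < 3 * M + c by apply: ltr_wpDl => //; rewrite mulr_ge0.
(* Positivity at [e] and at [- e] places [q.[0] + s.[e] * e] between 0 and [s.[e] * e + s.[- e] *
   e], so [|q.[0]|] is at most [3 * M * e]; this [e] makes that bound smaller than [c]. *)
pose e := c / (3 * M + c).
have e_gt0 : 0 < e by rewrite divr_gt0.
have e_le1 : e <= 1 by rewrite ler_pdivrMr // mul1r lerDr mulr_ge0.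
have eR : e \is Num.real by apply: gtr0_real.
have x_ge0 : 0 <= q.[0] + s.[e] * e.
  by have := p_ge0 e eR; rewrite pt pmulr_lge0.
have y_ge0 : 0 <= - (q.[0] - s.[- e] * e).
  have := p_ge0 (- e); rewrite rpredN => /(_ eR).
  by rewrite pt !mulrN -mulNr pmulr_lge0.
have sle t : `|t| <= e -> `|s.[t] * e| <= M * e.
  move=> te; rewrite normrM (gtr0_norm e_gt0) ler_pM2r // sM //.
  exact: le_trans te e_le1.
have se : `|s.[e] * e| <= M * e by rewrite sle // gtr0_norm.
have sNe : `|s.[- e] * e| <= M * e by rewrite sle // normrN gtr0_norm.
have xy : `|q.[0] + s.[e] * e| <= M * e + M * e.
  have xle : q.[0] + s.[e] * e <= s.[e] * e + s.[- e] * e.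
    by rewrite -subr_ge0 (_ : _ - _ = - (q.[0] - s.[- e] * e)) //; ring.
  rewrite ger0_norm //; apply: (le_trans xle).
  rewrite -[leLHS]ger0_norm; last exact: le_trans xle.
  exact: le_trans (ler_normD _ _) (lerD se sNe).
have : c <= 3 * M * e.
  rewrite /c -[q.[0]](addrK (s.[e] * e)); apply: (le_trans (ler_normB _ _)).
  by apply: (le_trans (lerD xy se)); rewrite le_eqVlt (_ : _ == _) //; apply/eqP; ring.
move=> cle; suff /(le_lt_trans cle) : 3 * M * e < c by rewrite ltxx.
rewrite /e mulrA ltr_pdivrMr // -subr_gt0 (_ : _ - _ = c * c); first exact: mulr_gt0.
by ring.
Qed.

Section CriticalPoint.
Variables (C : numClosedFieldType) (I : finType) (n : nat) (k : I -> nat).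
Variables (M : forall i, 'M[C]_(k i, n)) (a : I -> nat) (g : nat).

Lemma mxtrace_mulmx_adj_eq0 m p (Z : 'M[C]_(m, p)) : \tr (Z *m Z^t*) = 0 -> Z = 0.
Proof.
move=> tr0; have /psumr_eq0P Z0 : forall i, true -> 0 <= (Z *m Z^t*) i i.
  by move=> i _; rewrite mxE sumr_ge0 // => j _; rewrite !mxE mul_conjC_ge0.
apply/matrixP => i j; rewrite mxE; have := Z0 tr0 i isT; rewrite mxE.
have /psumr_eq0P : forall j, true -> 0 <= Z i j * (Z^t*) j i.
  by move=> j' _; rewrite !mxE mul_conjC_ge0.
by move=> H /H/(_ j isT)/eqP; rewrite !mxE mul_conjC_eq0 => /eqP.
Qed.

(** The orthogonal projection onto the row space of [M i], acting on row vectors from the right. *)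
Definition frame_projection i : 'M[C]_n :=
  (M i)^t* *m invmx (M i *m (M i)^t* ) *m M i.

Lemma frame_projection_adj i : M i *m (M i)^t* \in unitmx ->
  frame_projection i *m (M i)^t* = (M i)^t*.
Proof. by move=> uM; rewrite /frame_projection -!mulmxA mulVmx // mulmx1. Qed.

(* With P_i = frame_projection i, the function
   h |-> (\prod_i det (M_i h h^* M_i^* ) ^ a_i) / |det h| ^ (2 g) has at h = 1 in
   the direction of a hermitian matrix Z a derivative proportional to
   tr (Z (\sum_i a_i P_i - g)). *)
Lemma critical_frame :
  (forall h : 'M[C]_n, `|\det h| ^+ (2 * g) * \prod_i \det (M i *m (M i)^t* ) ^+ a i
     <= \prod_i \det (M i *m h *m h^t* *m (M i)^t* ) ^+ a i) ->
  (forall i, 0 < \det (M i *m (M i)^t* )) ->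
  \sum_i (a i)%:R *: frame_projection i = g%:R%:M.
Proof.
move=> minM detM.
pose G i := M i *m (M i)^t*; pose P := frame_projection.
have gram_unit i : G i \in unitmx by rewrite unitmxE unitfE gt_eqF.
(* The defect itself serves as the direction of variation: the derivative along [Z] is proportional
   to the trace of [Z *m Z], the squared norm of the hermitian matrix [Z]. *)
pose Z := \sum_i (a i)%:R *: P i - g%:R%:M.
have adjD m p (A B : 'M[C]_(m, p)) : (A + B)^t* = A^t* + B^t*.
  by rewrite linearD /= map_mxD.
have adjM m p q (A : 'M[C]_(m, p)) (B : 'M[C]_(p, q)) : (A *m B)^t* = B^t* *m A^t*.
  by rewrite trmx_mul map_mxM.
have adjZ m p c (A : 'M[C]_(m, p)) : (c *: A)^t* = c^* *: A^t*.
  by rewrite linearZ /= map_mxZ.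
have GK i : (G i)^t* = G i by rewrite adjM trmxCK.
have PK i : (P i)^t* = P i.
  rewrite /P /frame_projection !adjM trmxCK mulmxA; congr (_ *m _ *m _).
  by rewrite trmx_inv map_invmx -/(G i) GK.
have ZK : Z^t* = Z.
  rewrite /Z adjD -scaleN1r adjZ rmorphN1 !scaleN1r tr_scalar_mx map_scalar_mx rmorph_nat.
  congr (_ - _); rewrite (big_morph (fun A : 'M_n => A^t*) (id1 := 0) (@adjD n n)); last first.
    by rewrite trmx0 map_mx0.
  by apply: eq_bigr => i _; rewrite adjZ conjC_nat PK.
suff Z0 : Z = 0 by apply/subr0_eq.
apply: mxtrace_mulmx_adj_eq0; rewrite ZK.
pose L : 'M[{poly C}]_n := 1%:M + 'X *: map_mx polyC Z.
(* The inverse Gram matrix in front makes [v i] equal to 1 at 0, so that derivatives of products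
   become sums. For real [t] the matrix [1 + t Z] is its own adjoint, whence [L] occurs twice. *)
pose v i := \det (map_mx polyC (invmx (G i) *m M i) *m L *m L *m map_mx polyC ((M i)^t* )).
pose p := \prod_i v i ^+ a i - \det L ^+ (2 * g).
have evL t : map_mx (horner_eval t) L = 1%:M + t *: Z.
  by apply/matrixP => x y; rewrite !mxE /horner_eval !(hornerE, hornerMn).
have evC t m q (A : 'M[C]_(m, q)) : map_mx (horner_eval t) (map_mx polyC A) = A.
  by apply/matrixP => x y; rewrite !mxE /horner_eval hornerC.
have evv t i : (v i).[t] =
   (\det (G i))^-1 * \det (M i *m (1%:M + t *: Z) *m (1%:M + t *: Z) *m (M i)^t* ).
  rewrite -[LHS]/(horner_eval t (v i)) /v -det_map_mx !map_mxM !evL !evC.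
  by rewrite -!mulmxA det_mulmx det_inv.
have detL t : (\det L).[t] = \det (1%:M + t *: Z).
  by rewrite -[LHS]/(horner_eval t _) -det_map_mx evL.
have v0 i : (v i).[0] = 1.
  by rewrite evv scale0r addr0 !mulmx1 mulVf // gt_eqF.
have L0 : (\det L).[0] = 1 by rewrite detL scale0r addr0 det1.
have : deriv0 p = 0.
  apply: deriv0_eq0 => [t tR|]; last first.
    rewrite hornerD hornerN horner_prod big1 ?horner_exp ?L0 ?expr1n ?subrr // => i _.
    by rewrite horner_exp v0 expr1n.
  rewrite hornerD hornerN subr_ge0 horner_exp detL horner_prod.
  have hK : (1%:M + t *: Z)^t* = 1%:M + t *: Z.
    by rewrite adjD adjZ ZK (CrealP tR) trmx1 map_mx1.
  have detR : \det (1%:M + t *: Z) \is Num.real.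
    by apply/CrealP; rewrite -{2}hK det_map_mx det_tr.
  have dG : 0 < \prod_i \det (G i) ^+ a i by apply: prodr_gt0 => i _; rewrite exprn_gt0.
  rewrite -(ler_pM2r dG) -big_split /=.
  have := minM (1%:M + t *: Z); rewrite hK exprM real_normK // -exprM.
  move/le_trans; apply; rewrite le_eqVlt (_ : _ == _) //; apply/eqP/eq_bigr => i _.
  rewrite horner_exp evv -exprMn mulrC mulrA divff ?mul1r //.
  by rewrite gt_eqF.
pose dm m q (A : 'M[{poly C}]_(m, q)) := map_mx (@deriv0 C) A.
have dmM m q r (A : 'M[{poly C}]_(m, q)) (B : 'M[{poly C}]_(q, r)) :
    dm _ _ (A *m B) = dm _ _ A *m map_mx (horner_eval 0) B + map_mx (horner_eval 0) A *m dm _ _ B.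
  apply/matrixP => x y; rewrite !mxE /deriv0 raddf_sum horner_sum -big_split /=.
  by apply: eq_bigr => z _; rewrite !mxE /horner_eval derivM hornerD !hornerM.
have dmC m q (A : 'M[C]_(m, q)) : dm _ _ (map_mx polyC A) = 0.
  by apply/matrixP => x y; rewrite !mxE /deriv0 derivC horner0.
have ev0L : map_mx (horner_eval 0) L = 1%:M by rewrite evL scale0r addr0.
have dmL : dm _ _ L = Z.
  apply/matrixP => x y; rewrite !mxE /deriv0 derivD derivM derivX derivC mulr0 addr0 mul1r.
  by rewrite -[_ *+ _]polyCMn derivC add0r hornerC.
have dv i : deriv0 (v i) = \tr (Z *m P i) *+ 2.
  have evv1 : map_mx (horner_eval 0) (map_mx polyC (invmx (G i) *m M i) *m L *m L *m
      map_mx polyC ((M i)^t* )) = 1%:M.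
    by rewrite !map_mxM !evC ev0L !mulmx1 -mulmxA mulVmx.
  rewrite deriv0_det // -/(dm _ _ _) !dmM dmC !dmC dmL !map_mxM !evC ev0L.
  rewrite mul0mx !mulmx1 mulmx0 add0r addr0 mulmxDl mxtraceD -mulr2n; congr (_ *+ 2).
  by rewrite [RHS]mxtrace_mulC /P /frame_projection -!mulmxA [RHS]mxtrace_mulC -!mulmxA.
have dL : deriv0 (\det L) = \tr Z by rewrite deriv0_det // -/(dm _ _ _) dmL.
rewrite /p deriv0B deriv0_prod => [|i]; last by rewrite horner_exp v0 expr1n.
rewrite deriv0X // dL.
under eq_bigr => i _ do rewrite deriv0X // dv.
move=> E; suff : \tr (Z *m Z) *+ 2 = 0 by move/eqP; rewrite mulrn_eq0 => /eqP.
rewrite -E {2}/Z mulmxBr linearB /= mulrnBl; congr (_ - _).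
  rewrite mulmx_sumr raddf_sum /= -sumrMnl; apply: eq_bigr => i _.
  by rewrite -scalemxAr linearZ /= mulr_natl mulrnAC.
by rewrite mul_mx_scalar linearZ /= mulr_natl -mulrnA mulnC.
Qed.
End CriticalPoint.

(** * Minimization over positive definite hermitian matrices *)

Section SquaredModulus.
Variable R : rcfType.
Implicit Type z : R[i].

Definition sqmod z : R := complex.Re z ^+ 2 + complex.Im z ^+ 2.

Lemma sqmodE z : (sqmod z)%:C = `|z| ^+ 2.
Proof. exact: add_Re2_Im2. Qed.

Lemma sqmod_ge0 z : 0 <= sqmod z.
Proof. by rewrite addr_ge0 ?sqr_ge0. Qed.

Lemma sqmod_gt0 z : z != 0 -> 0 < sqmod z.
Proof. by move=> z0; rewrite -(ltcR 0) sqmodE exprn_gt0 // normr_gt0. Qed.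

End SquaredModulus.

Section Objective.
Variables (R : realType) (I : finType) (n : nat) (k : I -> nat).
Variables (B : forall i, 'M[R[i]]_(k i, n)) (a : I -> nat) (g : nat).
Implicit Types (w : 'M[R[i]]_n) (lam r : 'I_n -> R).

(** The Cauchy-Binet expansion of a Gram determinant, as a real number. The monomials in the
    eigenvalues [lam] have nonnegative coefficients, so any single one bounds the sum from below. *)
Definition gram_weight i w lam : R :=
  \sum_(f : {ffun 'I_(k i) -> 'I_n})
    (\prod_b lam (f b)) * sqmod (\det (colsub f (B i *m w))).

Definition herm_of w lam : 'M[R[i]]_n := w *m diag_mx (\row_s (lam s)%:C) *m w^t*.

Lemma gram_weightE i w lam : (gram_weight i w lam)%:C =
  (k i)`!%:R * \det (B i *m herm_of w lam *m (B i)^t* ).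
Proof.
have -> : B i *m herm_of w lam *m (B i)^t* =
    (B i *m w *m diag_mx (\row_s (lam s)%:C)) *m (B i *m w)^t*.
  by rewrite /herm_of trmx_mul map_mxM !mulmxA.
rewrite det_mulmx_sum /gram_weight rmorph_sum; apply: eq_bigr => f _.
have -> : colsub f (B i *m w *m diag_mx (\row_s (lam s)%:C)) =
    colsub f (B i *m w) *m diag_mx (\row_b (lam (f b))%:C).
  by rewrite !mul_mx_diag; apply/matrixP => x y; rewrite !mxE.
have -> : rowsub f ((B i *m w)^t* ) = (colsub f (B i *m w))^t*.
  by apply/matrixP => x y; rewrite !mxE.
rewrite det_mulmx det_diag det_map_mx det_tr rmorphM /= sqmodE normCK rmorph_prod /=.
rewrite mulrCA mulrA; congr (_ * _ * _).
by apply: eq_bigr => b _; rewrite mxE.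
Qed.

(** Decreasing eigenvalues are parametrized by their consecutive ratios [r j] in ]0, 1], with [r] at
    index 0 as overall scale; a degeneration means that some later ratio tends to 0. *)
Definition scales r (s : 'I_n) : R := \prod_(j < n | (j <= s)%N) r j.

Lemma scales_gt0 r s : (forall j, 0 < r j) -> 0 < scales r s.
Proof. by move=> r0; apply: prodr_gt0. Qed.

Definition objective_num w r : R := \prod_i gram_weight i w (scales r) ^+ a i.
Definition objective_den r : R := (\prod_s scales r s) ^+ g.

(** The left-hand side is the exponent of [r j] in the monomial selected by [f], and [g * (n - j)]
    is its exponent in the denominator of the objective. *)
Definition admissible (f : forall i, 'I_(k i) -> 'I_n) : Prop :=
  forall j : 'I_n, (0 < j)%N ->
    (\sum_i a i * #|[set b | (j <= f i b)%N]| < g * (n - j))%N.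

Hypothesis balanced : (\sum_i a i * k i = g * n)%N.

Lemma objective_lower_bound (f : forall i, 'I_(k i) -> 'I_n) w r :
  admissible f -> (forall j, 0 < r j <= 1) ->
  (\prod_i sqmod (\det (colsub (f i) (B i *m w))) ^+ a i) * objective_den r <=
    objective_num w r * \prod_(j < n | (0 < j)%N) r j.
Proof.
move=> fP r01; have r0 j : 0 < r j by case/andP: (r01 j).
have r1 j : r j <= 1 by case/andP: (r01 j).
have scaleE m (h : 'I_m -> 'I_n) :
    \prod_b scales r (h b) = \prod_j r j ^+ #|[set b | (j <= h b)%N]|.
  rewrite /scales (exchange_big_dep xpredT) //=; apply: eq_bigr => j _.
  by rewrite prodr_const; congr (_ ^+ _); apply: eq_card => b; rewrite !inE.
have step1 : \prod_i ((\prod_b scales r (f i b)) *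
    sqmod (\det (colsub (f i) (B i *m w)))) ^+ a i <= objective_num w r.
  apply: ler_prod => i _; rewrite exprn_ge0 /=; last first.
    by rewrite mulr_ge0 ?sqmod_ge0 // prodr_ge0 // => b _; apply/ltW/scales_gt0.
  apply: lerXn2r; rewrite ?nnegrE.
  - by rewrite mulr_ge0 ?sqmod_ge0 // prodr_ge0 // => b _; apply/ltW/scales_gt0.
  - apply: sumr_ge0 => h _.
    by rewrite mulr_ge0 ?sqmod_ge0 // prodr_ge0 // => b _; apply/ltW/scales_gt0.
  rewrite /gram_weight (bigD1 (finfun (f i))) //=.
  rewrite (_ : \prod_b _ = \prod_b scales r (finfun (f i) b)); last first.
    by apply: eq_bigr => b _; rewrite ffunE.
  rewrite (_ : colsub (f i) _ = colsub (finfun (f i)) (B i *m w)); last first.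
    by apply/matrixP => x y; rewrite !mxE ffunE.
  rewrite lerDl; apply: sumr_ge0 => h _.
  by rewrite mulr_ge0 ?sqmod_ge0 // prodr_ge0 // => b _; apply/ltW/scales_gt0.
have P0 : 0 <= \prod_(j < n | (0 < j)%N) r j by apply: prodr_ge0 => j _; apply: ltW.
apply: le_trans (ler_wpM2r P0 step1).
under [X in _ <= X * _]eq_bigr => i _ do rewrite exprMn.
rewrite big_split /= mulrAC [leLHS]mulrC; apply: ler_wpM2r.
  by apply: prodr_ge0 => i _; rewrite exprn_ge0 ?sqmod_ge0.
have -> : objective_den r = \prod_j r j ^+ (g * (n - j)).
  rewrite /objective_den (scaleE n id) -prodrXl; apply: eq_bigr => j _.
  rewrite -exprM mulnC; congr (_ ^+ (_ * _)).
  rewrite -sum1_card (eq_bigl (fun b : 'I_n => (j <= b)%N)) => [|b]; last by rewrite inE.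
  rewrite -(big_mkord (fun b => j <= b)%N (fun=> 1%N)).
  by rewrite -(big_nat_widenl j 0 n xpredT) // sum_nat_const_nat muln1.
have -> : \prod_i (\prod_b scales r (f i b)) ^+ a i =
    \prod_j r j ^+ (\sum_i a i * #|[set b | (j <= f i b)%N]|).
  under eq_bigr => i _ do rewrite scaleE -prodrXl.
  rewrite exchange_big /=; apply: eq_bigr => j _.
  rewrite expr_sum; apply: eq_bigr => i _.
  by rewrite -exprM mulnC.
rewrite [X in _ <= _ * X]big_mkcond /= -big_split /=.
apply: ler_prod => j _; rewrite exprn_ge0 ?(ltW (r0 j)) //=.
(* For [j] > 0 admissibility leaves room for one more factor [r j]; for [j] = 0 the two exponents
   coincide by balance. *)
case: ltnP => j0.
  rewrite -exprSr. apply: ler_wiXn2l => //; first exact: ltW.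
  exact: fP.
rewrite mulr1 (_ : nat_of_ord j = 0%N) ?subn0; last by apply/eqP; rewrite -leqn0.
rewrite -balanced le_eqVlt; apply/orP; left; apply/eqP; congr (_ ^+ _).
apply: eq_bigr => i _; congr (_ * _)%N; rewrite -[LHS]card_ord.
by apply: eq_card => b; rewrite inE leq0n.
Qed.

End Objective.

(** * Existence of a minimum by compactness *)

Section Minimization.
Import classical_sets topology normedtype derive.
Import numFieldNormedType.Exports.
Local Open Scope classical_set_scope.

Section ContinuousSums.
Variables (R : realType) (X : topologicalType).

Lemma continuous_bigsum (J : Type) (s : seq J) (P : pred J) (f : J -> X -> R) :
  (forall j, continuous (f j)) -> continuous (fun x => \sum_(j <- s | P j) f j x).
Proof.
move=> cf; elim: s => [|j s IH].
  by under eq_fun do rewrite big_nil; apply: cst_continuous.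
under eq_fun do rewrite big_cons; case: (P j) => // x.
exact: continuousD (cf j x) (IH x).
Qed.

Lemma continuous_bigprod (J : Type) (s : seq J) (P : pred J) (f : J -> X -> R) :
  (forall j, continuous (f j)) -> continuous (fun x => \prod_(j <- s | P j) f j x).
Proof.
move=> cf; elim: s => [|j s IH].
  by under eq_fun do rewrite big_nil; apply: cst_continuous.
under eq_fun do rewrite big_cons; case: (P j) => // x.
exact: continuousM (cf j x) (IH x).
Qed.

Lemma continuous_pow (f : X -> R) m : continuous f -> continuous (fun x => f x ^+ m).
Proof.
move=> cf; elim: m => [|m IH]; first by under eq_fun do rewrite expr0; apply: cst_continuous.
by under eq_fun do rewrite exprS; move=> x; apply: continuousM (cf x) (IH x).
Qed.

Lemma continuous_quotient (f h : X -> R) x : continuous f -> continuous h -> h x != 0 ->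
  {for x, continuous (fun x => f x / h x)}.
Proof. by move=> cf ch h0; apply: cvgM (cf x) (cvgV h0 (ch x)). Qed.

(** Continuity is expressed through the real and imaginary parts, so that only the topology of [R]
    is involved. *)
Definition ccontinuous (f : X -> R[i]) : Prop :=
  continuous (fun x => complex.Re (f x)) /\ continuous (fun x => complex.Im (f x)).

Lemma ccontinuous_cst z : ccontinuous (fun=> z).
Proof. by split; apply: cst_continuous. Qed.

Lemma ccontinuousD f1 f2 : ccontinuous f1 -> ccontinuous f2 ->
  ccontinuous (fun x => f1 x + f2 x).
Proof.
move=> [r1 i1] [r2 i2]; split.
  rewrite (_ : (fun _ => _) = (fun x => complex.Re (f1 x) + complex.Re (f2 x))).
    by move=> x; apply: continuousD (r1 x) (r2 x).
  by apply/funext => x; case: (f1 x); case: (f2 x).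
rewrite (_ : (fun _ => _) = (fun x => complex.Im (f1 x) + complex.Im (f2 x))).
  by move=> x; apply: continuousD (i1 x) (i2 x).
by apply/funext => x; case: (f1 x); case: (f2 x).
Qed.

Lemma ccontinuousM f1 f2 : ccontinuous f1 -> ccontinuous f2 ->
  ccontinuous (fun x => f1 x * f2 x).
Proof.
move=> [r1 i1] [r2 i2]; split.
  rewrite (_ : (fun _ => _) = (fun x => complex.Re (f1 x) * complex.Re (f2 x) -
      complex.Im (f1 x) * complex.Im (f2 x))).
    move=> x.
    exact: continuousB (continuousM (r1 x) (r2 x)) (continuousM (i1 x) (i2 x)).
  by apply/funext => x; case: (f1 x); case: (f2 x).
rewrite (_ : (fun _ => _) = (fun x => complex.Re (f1 x) * complex.Im (f2 x) +
    complex.Im (f1 x) * complex.Re (f2 x))).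
  move=> x.
  exact: continuousD (continuousM (r1 x) (i2 x)) (continuousM (i1 x) (r2 x)).
by apply/funext => x; case: (f1 x); case: (f2 x).
Qed.

Lemma ccontinuous_sum (J : Type) (s : seq J) (P : pred J) (f : J -> X -> R[i]) :
  (forall j, ccontinuous (f j)) -> ccontinuous (fun x => \sum_(j <- s | P j) f j x).
Proof.
move=> cf; elim: s => [|j s IH].
  by under eq_fun do rewrite big_nil; apply: ccontinuous_cst.
under eq_fun do rewrite big_cons; case: (P j) => //.
exact: ccontinuousD (cf j) IH.
Qed.

Lemma ccontinuous_prod (J : Type) (s : seq J) (P : pred J) (f : J -> X -> R[i]) :
  (forall j, ccontinuous (f j)) -> ccontinuous (fun x => \prod_(j <- s | P j) f j x).
Proof.
move=> cf; elim: s => [|j s IH].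
  by under eq_fun do rewrite big_nil; apply: ccontinuous_cst.
under eq_fun do rewrite big_cons; case: (P j) => //.
exact: ccontinuousM (cf j) IH.
Qed.

Lemma ccontinuous_det m (A : X -> 'M[R[i]]_m) :
  (forall b c, ccontinuous (fun x => A x b c)) -> ccontinuous (fun x => \det (A x)).
Proof.
move=> cA; apply: ccontinuous_sum => s; apply: ccontinuousM; first exact: ccontinuous_cst.
by apply: ccontinuous_prod => b; apply: cA.
Qed.

Lemma continuous_sqmod f : ccontinuous f -> continuous (fun x => sqmod (f x)).
Proof.
move=> [r i] x.
have cr : continuous (fun x => complex.Re (f x) ^+ 2) by apply: continuous_pow.
have ci : continuous (fun x => complex.Im (f x) ^+ 2) by apply: continuous_pow.
exact: continuousD (cr x) (ci x).
Qed.

End ContinuousSums.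

Section Minimizer.
Variables (R : realType) (I : finType) (n : nat) (k : I -> nat).
Variables (B : forall i, 'M[R[i]]_(k i, n)) (a : I -> nat) (g : nat).
Hypothesis freeB : forall i, row_free (B i).
Hypothesis balanced : (\sum_i a i * k i = g * n)%N.
Hypothesis stable : forall E : 'M[R[i]]_n, (0 < \rank E < n)%N ->
  (\sum_i a i * \rank (B i :&: E)%MS < g * \rank E)%N.

(** Let [E] be the space of rows [x] for which [x *m w] vanishes in its first [j] entries; it has
    dimension [n - j]. At most [rank (B i :&: E)] pivots of [B i *m w] have index at least [j], so
    stability at [E] is admissibility at [j]. *)
Lemma admissible_pivots (w : 'M[R[i]]_n) : w \in unitmx ->
  exists2 f : forall i, 'I_(k i) -> 'I_n, admissible a g f &
    forall i, \det (colsub (f i) (B i *m w)) != 0.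
Proof.
move=> uw.
have freeBw i : row_free (B i *m w).
  by rewrite /row_free mxrankMfree ?row_free_unit //; apply: freeB.
have piv i : { f : 'I_(k i) -> 'I_n | \det (colsub f (B i *m w)) != 0 /\
    forall j, (j <= n)%N ->
      (\rank (B i *m w *m pid_mx j : 'M_(k i, n)) <= #|[set b | (f b < j)%N]%SET|)%N}.
  by apply: cid; have [f f1 f2] := pivot_columns (freeBw i); exists f; split.
exists (fun i => sval (piv i)) => [j j0|i]; last by case: (svalP (piv i)).
have jn : (j <= n)%N by apply/ltnW/ltn_ord.
pose D : 'M[R[i]]_n := pid_mx j; pose E := kermx (w *m D).
have rkE : \rank E = (n - j)%N.
  rewrite mxrank_ker (eqmxMfull D) ?row_full_unit // rank_pid_mx //.
have := @stable E; rewrite rkE; have -> : (0 < n - j < n)%N.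
  by have := ltn_ord j; lia.
move/(_ isT); apply: leq_trans; rewrite ltnS; apply: leq_sum => i _; rewrite leq_mul2l.
apply/orP; right; have [_ /(_ j jn)] := svalP (piv i).
set f := sval (piv i); rewrite -mulmxA -/D.
have := mxrank_mul_ker (B i) (w *m D); rewrite -/E.
have -> : \rank (B i) = k i by apply/eqP/freeB.
have -> : #|[set b | (j <= f b)%N]%SET| = (k i - #|[set b | (f b < j)%N]%SET|)%N.
  rewrite [LHS]cardsCs card_ord; congr (_ - _)%N.
  by apply: eq_card => b; rewrite !inE -ltnNge.
by move=> rk le; rewrite leq_subLR; apply: (leq_trans (eq_leq (esym rk))); rewrite leq_add2r.
Qed.

(** Real coordinates of a pair [(w, r)]: the boolean selects the real or the imaginary part of an
    entry of [w]. In the product topology Tychonoff's theorem makes boxes compact. *)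
Let J := ('I_n * 'I_n * bool + 'I_n)%type.
Let X := {ptws J -> R}.
Let w_of (p : X) : 'M[R[i]]_n := \matrix_(b, c) (p (inl (b, c, true)) +i* p (inl (b, c, false))).
Let r_of (p : X) (j : 'I_n) : R := p (inr j).

Let proj_cont (j : J) : continuous (fun p : X => p j).
Proof. exact: (@proj_continuous J (fun=> R) j). Qed.

Let w_cont b c : ccontinuous (fun p : X => w_of p b c).
Proof.
split.
  rewrite (_ : (fun _ => _) = (fun p : X => p (inl (b, c, true)))); first exact: proj_cont.
  by apply/funext => p; rewrite mxE.
rewrite (_ : (fun _ => _) = (fun p : X => p (inl (b, c, false)))); first exact: proj_cont.
by apply/funext => p; rewrite mxE.
Qed.

Let minor_cont i (f : 'I_(k i) -> 'I_n) :
  continuous (fun p : X => sqmod (\det (colsub f (B i *m w_of p)))).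
Proof.
apply: continuous_sqmod; apply: ccontinuous_det => b c.
rewrite (_ : (fun _ => _) = (fun p : X => \sum_j B i b j * w_of p j (f c))); last first.
  by apply/funext => p; rewrite !mxE.
by apply: ccontinuous_sum => j; apply: ccontinuousM; [exact: ccontinuous_cst|exact: w_cont].
Qed.

Let num_cont : continuous (fun p : X => objective_num B a (w_of p) (r_of p)).
Proof.
apply: continuous_bigprod => i; apply: continuous_pow; apply: continuous_bigsum => f x.
have cl : continuous (fun p : X => \prod_b scales (r_of p) (f b)).
  by apply: continuous_bigprod => b; apply: continuous_bigprod => j; apply: proj_cont.
exact: continuousM (cl x) (@minor_cont i f x).
Qed.

Let den_cont : continuous (fun p : X => objective_den g (r_of p)).
Proof.
apply: continuous_pow; apply: continuous_bigprod => s; apply: continuous_bigprod => j.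
exact: proj_cont.
Qed.

(* A compact set which contains the unitary matrices; unitarity itself plays no
   role in the estimates. *)
Let box (d : R) : set X := [set p | [/\ forall j, -1 <= p j <= 1,
  forall j, d <= p (inr j) <= 1 & sqmod (\det (w_of p)) = 1]].

Let box_compact d : compact (box d).
Proof.
pose itv (j : J) : set R := if j is inl _ then `[-1, 1]%classic else (`[-1, 1] `&` `[d, 1])%classic.
have citv j : compact (itv j).
  case: j => [j|j]; first exact: segment_compact.
  have sub : itv (inr j) `<=` `[-1, 1]%classic by move=> x [].
  apply: subclosed_compact sub; last exact: segment_compact.
  by apply: closedI; apply: interval_closed.
have -> : box d = [set p : X | forall j, itv j (p j)] `&`
    ((fun p : X => sqmod (\det (w_of p))) @^-1` [set 1]).
  apply/seteqP; split=> p.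
    move=> [p1 p2 p3]; split=> // -[j|j] /=; rewrite in_itv /= p1 //.
    by split=> //; rewrite in_itv /= p2.
  move=> [pitv p3]; split=> // [[j|j]|j].
  - by have := pitv (inl j); rewrite /= in_itv.
  - by have [] := pitv (inr j); rewrite /= in_itv.
  - by have [_] := pitv (inr j); rewrite /= in_itv.
apply: (@subclosed_compact _ _ [set p : X | forall j, itv j (p j)]); last by move=> x [].
  apply: closedI.
    apply: compact_closed; last exact: (@tychonoff J (fun=> R) itv).
    exact: (@hausdorff_product J (fun=> R)).
  have /continuous_closedP := continuous_sqmod (ccontinuous_det w_cont); apply.
  exact: closed_eq.
exact: (@tychonoff J (fun=> R) itv).
Qed.

Let in_box (d : R) (w : 'M[R[i]]_n) (r : 'I_n -> R) :
  (forall b c, -1 <= complex.Re (w b c) <= 1 /\ -1 <= complex.Im (w b c) <= 1) ->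
  (forall j, d <= r j <= 1) -> 0 <= d -> sqmod (\det w) = 1 ->
  exists2 p : X, box d p & w_of p = w /\ r_of p = r.
Proof.
move=> wP rP d0 detw.
pose p : X := fun j => match j with
  | inl (b, c, e) => if e then complex.Re (w b c) else complex.Im (w b c)
  | inr j => r j end.
have wE : w_of p = w by apply/matrixP => b c; rewrite mxE /=; case: (w b c).
exists p => //; split=> //; last by rewrite wE.
move=> [[[b c] []]|j] /=; [by have [] := wP b c | by have [] := wP b c |].
by have /andP[dr ->] := rP j; rewrite andbT (le_trans _ (le_trans d0 dr)) // lerN10.
Qed.

Let box_unit d p : box d p -> w_of p \in unitmx.
Proof.
move=> [_ _ det1]; rewrite unitmxE unitfE; apply: contra_eq_neq det1 => ->.
by rewrite /sqmod /= expr0n /= addr0 eq_sym oner_neq0.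
Qed.

(** The pivots chosen at a point have nonzero minors nearby, which gives a local constant;
    compactness makes it uniform. The ratios [r] are quantified apart from the point of the box, so
    they may come arbitrarily close to 0. *)
Let uniform_bound (d : R) : exists2 c : R, 0 < c &
  forall p, box d p -> forall r, (forall j, 0 < r j <= 1) ->
    c * objective_den g r <= objective_num B a (w_of p) r * \prod_(j < n | (0 < j)%N) r j.
Proof.
have := @box_compact d => /compact_near_coveringP/near_covering_withinP nc.
pose Q (c : R) (p : X) := forall r, (forall j, 0 < r j <= 1) ->
    c * objective_den g r <= objective_num B a (w_of p) r * \prod_(j < n | (0 < j)%N) r j.
have : \forall c \near (0 : R)^'+, box d `<=` Q c.
  apply: nc => p bp; have [f fadm fdet] := admissible_pivots (box_unit bp).
  pose v (q : X) := \prod_i sqmod (\det (colsub (f i) (B i *m w_of q))) ^+ a i.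
  have cv : continuous v by apply: continuous_bigprod => i; apply/continuous_pow/minor_cont.
  have vp : 0 < v p by apply: prodr_gt0 => i _; rewrite exprn_gt0 ?sqmod_gt0.
  have vp2 : v p / 2 < v p by rewrite ltr_pdivrMr // ltr_pMr // ltr1n.
  have near_v : \forall q \near p, v p / 2 < v q by apply: (cvgr_gt (v p) (cv p)).
  have near_c : \forall c \near (0 : R)^'+, c < v p / 2.
    by apply: nbhs_right_lt; rewrite divr_gt0.
  exists ([set q | v p / 2 < v q], [set c : R | c < v p / 2]) => //= -[q c] [/= vq cv2] bq r r01.
  apply: le_trans (objective_lower_bound B balanced (w_of q) fadm r01).
  apply: ler_wpM2r; last exact: ltW (lt_trans cv2 vq).
  apply: exprn_ge0; apply: prodr_ge0 => s _; apply/ltW/scales_gt0 => j.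
  by case/andP: (r01 j).
move=> /(filterI (nbhs_right_gt (0 : R)))/filter_ex[c [c0 cQ]].
by exists c => // p bp; apply: cQ.
Qed.

Lemma objective_num_ge0 (w : 'M[R[i]]_n) (r : 'I_n -> R) :
  (forall j, 0 < r j) -> 0 <= objective_num B a w r.
Proof.
move=> r0; apply: prodr_ge0 => i _; apply/exprn_ge0/sumr_ge0 => f _.
by rewrite mulr_ge0 ?sqmod_ge0 // prodr_ge0 // => b _; apply/ltW/scales_gt0.
Qed.

Lemma objective_den_gt0 (r : 'I_n -> R) : (forall j, 0 < r j) -> 0 < objective_den g r.
Proof. by move=> r0; apply/exprn_gt0/prodr_gt0 => s _; apply: scales_gt0. Qed.

Lemma objective_minimizer : exists (w0 : 'M[R[i]]_n) (r0 : 'I_n -> R),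
  [/\ sqmod (\det w0) = 1, forall j, 0 < r0 j & forall (w : 'M[R[i]]_n) (r : 'I_n -> R),
    (forall b c, -1 <= complex.Re (w b c) <= 1 /\ -1 <= complex.Im (w b c) <= 1) ->
    sqmod (\det w) = 1 -> (forall j, 0 < r j <= 1) -> (forall j : 'I_n, j = 0%N :> nat -> r j = 1) ->
    objective_num B a w0 r0 * objective_den g r <= objective_num B a w r * objective_den g r0].
Proof.
(* The constant [c] must be available before the lower bound [d] on the ratios is chosen. The box
   with bound 0 serves only for its component [w]. *)
have [c c0 cP] := uniform_bound 0.
pose obj (w : 'M[R[i]]_n) (r : 'I_n -> R) := objective_num B a w r / objective_den g r.
have bound (w : 'M[R[i]]_n) (r : 'I_n -> R) :
    (forall b c, -1 <= complex.Re (w b c) <= 1 /\ -1 <= complex.Im (w b c) <= 1) ->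
    sqmod (\det w) = 1 -> (forall j, 0 < r j <= 1) ->
    c <= obj w r * \prod_(j < n | (0 < j)%N) r j.
  move=> wP det1w r01; have r0 j : 0 < r j by case/andP: (r01 j).
  have [|p bp [<- _]] := in_box wP (r := fun=> 1) _ (lexx 0) det1w.
    by move=> j; rewrite ler01 lexx.
  by rewrite /obj mulrAC ler_pdivlMr ?objective_den_gt0 // cP.
have id01 b b' : -1 <= complex.Re ((1%:M : 'M[R[i]]_n) b b') <= 1 /\
    -1 <= complex.Im ((1%:M : 'M[R[i]]_n) b b') <= 1.
  by rewrite mxE; case: (b == b'); rewrite ?mulr1n ?mulr0n /=; split; apply/andP; split; lra.
have det1s : sqmod (\det (1%:M : 'M[R[i]]_n)) = 1.
  by rewrite det1 /sqmod /= expr1n expr0n addr0.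
have obj1 : 0 < obj 1%:M (fun=> 1).
  apply: lt_le_trans c0 _; have := bound 1%:M (fun=> 1) id01 det1s.
  by rewrite big1 // mulr1; apply => j; rewrite ltr01 lexx.
(* If the objective does not exceed its value at the identity, then [c] is at most that value times
   the product of the ratios, hence times any single [r j] with [j] > 0; so [r j] is at least [d].
   All other pairs are beaten by the identity, which is in the box. *)
pose d := Num.min 1 (c / obj 1%:M (fun=> 1)).
have d_gt0 : 0 < d by rewrite lt_min ltr01 divr_gt0.
have d_le1 : d <= 1 by rewrite ge_min lexx.
have [|p1 bp1 [w1 r1]] := in_box id01 (r := fun=> 1) _ (ltW d_gt0) det1s.
  by move=> j; rewrite d_le1 lexx.
have objc : {within box d, continuous (fun p : X => obj (w_of p) (r_of p))}.
  apply: continuous_in_subspaceT => p; rewrite inE => -[_ rP _].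
  have den0 : objective_den g (r_of p) != 0.
    rewrite gt_eqF // objective_den_gt0 // => j.
    by apply: lt_le_trans d_gt0 _; case/andP: (rP j).
  exact: (continuous_quotient (f := fun p => objective_num B a (w_of p) (r_of p)) num_cont den_cont den0).
have [p0] := compact_EVT_min (ex_intro _ p1 bp1) (@box_compact d) objc.
rewrite inE => bp0 p0min; have [_ r0P _] := bp0.
have r0 j : 0 < r_of p0 j by apply: lt_le_trans d_gt0 _; case/andP: (r0P j).
exists (w_of p0), (r_of p0); split=> // [|w r wP det1w r01 rfst]; first by case: bp0.
have rgt0 j : 0 < r j by case/andP: (r01 j).
have [den0 den] := (objective_den_gt0 r0, objective_den_gt0 rgt0).
rewrite -ler_pdivlMr // mulrAC -ler_pdivrMr // -/(obj w r) -/(obj (w_of p0) (r_of p0)).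
have [le1|/ltW gt1] := leP (obj w r) (obj 1%:M (fun=> 1)); last first.
  by apply: le_trans gt1; rewrite -w1 -r1; apply: p0min; rewrite inE.
have [|p bp [<- <-]] := in_box wP (r := r) _ (ltW d_gt0) det1w; last by apply: p0min; rewrite inE.
move=> j; have /andP[_ ->] := r01 j; rewrite andbT.
(* The ratio of index 0 is a mere scale which the bound does not control; it is normalized to 1. *)
have [j0|j0] := posnP j; first by rewrite rfst.
apply: (@le_trans _ _ (c / obj 1%:M (fun=> 1))); first by rewrite ge_min lexx orbT.
rewrite ler_pdivrMr // mulrC; apply: (le_trans (bound w r wP det1w r01)).
apply: ler_pM => //; first by rewrite divr_ge0 ?objective_num_ge0 // ltW.
  by apply: prodr_ge0 => j' _; apply: ltW.
rewrite (bigD1 j) //= ler_piMr ?(ltW (rgt0 j)) // prodr_ile1 // => j' _.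
by case/andP: (r01 j') => /ltW -> ->.
Qed.

End Minimizer.

End Minimization.

Section Gram.
Variables (C : numClosedFieldType) (k n : nat) (M : 'M[C]_(k, n)).

Lemma det_gram_sum : k`!%:R * \det (M *m M^t* ) =
  \sum_(f : {ffun 'I_k -> 'I_n}) `|\det (colsub f M)| ^+ 2.
Proof.
rewrite det_mulmx_sum; apply: eq_bigr => f _; rewrite normCK; congr (_ * _).
by rewrite -det_tr -det_map_mx; congr (\det _); apply/matrixP => x y; rewrite !mxE.
Qed.

Lemma det_gram_ge0 : 0 <= \det (M *m M^t* ).
Proof.
have k0 : 0 < k`!%:R :> C by rewrite ltr0n fact_gt0.
by rewrite -(pmulr_rge0 _ k0) det_gram_sum sumr_ge0 // => f _; rewrite exprn_ge0.
Qed.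

Lemma det_gram_gt0 : row_free M -> 0 < \det (M *m M^t* ).
Proof.
move=> /pivot_columns[f f0 _]; have k0 : 0 < k`!%:R :> C by rewrite ltr0n fact_gt0.
rewrite -(pmulr_rgt0 _ k0) det_gram_sum (bigD1 (finfun f)) //=.
apply: ltr_wpDr; first by rewrite sumr_ge0 // => h _; rewrite exprn_ge0.
rewrite exprn_gt0 // normr_gt0; move: f0; congr (\det _ != 0).
by apply/matrixP => x y; rewrite !mxE ffunE.
Qed.

End Gram.

Lemma sorting_perm (R : realDomainType) n (mu : 'I_n -> R) :
  exists s : 'S_n, forall i j : 'I_n, (i <= j)%N -> mu (s j) <= mu (s i).
Proof.
pose leT x y := mu y <= mu x; pose t := sort leT (ord_tuple n).
have [p pE] : exists p : 'S_n, t = [tuple tnth (ord_tuple n) (p i) | i < n].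
  by apply/tuple_permP; rewrite perm_sort.
exists p => i j ij; have leT_tr : transitive leT by move=> x y z /[swap]; apply: le_trans.
have tP x : nth x t x = p x by rewrite pE -tnth_nth tnth_mktuple tnth_ord_tuple.
have st : sorted leT t by apply: sort_sorted => x y; apply: le_total.
have sz : size t = n by rewrite pE size_tuple.
have := sorted_leq_nth leT_tr (fun x => lexx (mu x)) i st.
move=> /(_ i j); rewrite !inE sz !ltn_ord => /(_ isT isT ij).
by rewrite /leT tP (set_nth_default j) ?sz // tP.
Qed.

(** * Spectral normal form of positive definite matrices *)

Section NormalForm.
Variable R : realType.

Lemma scales_ratio n (lam : 'I_n -> R) : (forall s, 0 < lam s) ->
  (forall i j : 'I_n, (i <= j)%N -> lam j <= lam i) ->
  exists t (r : 'I_n -> R), [/\ 0 < t, forall j, 0 < r j <= 1,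
    forall j : 'I_n, j = 0%N :> nat -> r j = 1 & forall s, lam s = t * scales r s].
Proof.
case: n lam => [|n] lam lam0 lamS.
  by exists 1, (fun=> 1); split=> // -[].
pose r (j : 'I_n.+1) := if (j : nat) is j'.+1 then lam j / lam (inord j') else 1.
exists (lam ord0), r; split=> // [j|j j0|s].
- rewrite /r; case E: (j : nat) => [|j']; first by rewrite ltr01 lexx.
  have j'n : (j' < n.+1)%N by rewrite ltnW // -E.
  rewrite divr_gt0 //= ler_pdivrMr // mul1r; apply: lamS.
  by rewrite inordK // E.
- by rewrite /r j0.
case: s => s sn; elim: s sn => [|s IH] sn.
  rewrite /scales (bigD1 ord0) //= big1 => [|i].
    by rewrite /r /= !mulr1; congr lam; apply: val_inj.
  by rewrite leqn0 -val_eqE /= => /andP[/eqP->].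
have sn' := ltnW sn.
rewrite /scales (bigD1 (Ordinal sn)) //=.
rewrite (eq_bigl (fun j : 'I_n.+1 => (j <= Ordinal sn')%N)) => [|i]; last first.
  by rewrite -val_eqE /=; lia.
rewrite -/(scales r (Ordinal sn')) mulrCA -IH /r /=.
have -> : inord s = Ordinal sn' by apply: val_inj; rewrite /= inordK.
by rewrite divfK // gt_eqF.
Qed.

Lemma herm_of_col_perm n (w : 'M[R[i]]_n) lam (p : 'S_n) :
  herm_of (col_perm p w) (fun s => lam (p s)) = herm_of w lam.
Proof.
apply/matrixP => b c; rewrite !mxE [RHS](reindex_inj (@perm_inj _ p)) /=.
by apply: eq_bigr => s _; rewrite !mul_mx_diag !mxE.
Qed.

(** The spectral theorem with eigenvalues in decreasing order and the scale [t] taken out. Of the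
    unitary matrix [w] only bounded entries and a determinant of modulus 1 are recorded, as in the
    compact box. *)
Lemma posdef_normal_form n (A : 'M[R[i]]_n) : A \in unitmx ->
  exists (w : 'M[R[i]]_n) t (r : 'I_n -> R),
  [/\ A *m A^t* = t%:C *: herm_of w (scales r), 0 < t,
    (forall b c, -1 <= complex.Re (w b c) <= 1 /\ -1 <= complex.Im (w b c) <= 1) /\
    sqmod (\det w) = 1,
    forall j, 0 < r j <= 1 & forall j : 'I_n, j = 0%N :> nat -> r j = 1].
Proof.
move=> uA; pose H := A *m A^t*.
have HK : H^t* = H by rewrite trmx_mul map_mxM trmxCK.
have /orthomx_spectralP : H \is normalmx by apply/normalmxP; rewrite HK.
set P := spectralmx H; set sp := spectral_diag H => HE.
have uP : P \is unitarymx by apply: spectral_unitarymx.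
have spE s : sp 0 s = \sum_j `|(P *m A) s j| ^+ 2.
  have : P *m H *m P^t* = diag_mx sp.
    by rewrite HE !mulmxA mulmxV ?spectral_unit // mul1mx -mulmxA (unitarymxP uP) mulmx1.
  have -> : P *m H *m P^t* = (P *m A) *m (P *m A)^t* by rewrite trmx_mul map_mxM !mulmxA.
  move=> /matrixP/(_ s s); rewrite [RHS]mxE eqxx mulr1n => <-; rewrite mxE.
  by apply: eq_bigr => j _; rewrite normCK !mxE.
have sp0 s : 0 < sp 0 s.
  rewrite spE lt_neqAle sumr_ge0 ?andbT => [|j _]; last by rewrite exprn_ge0.
  apply/negP; rewrite eq_sym => /eqP sum0.
  have rs0 : row s (P *m A) = 0.
    apply/rowP => j; rewrite [LHS]mxE [RHS]mxE; apply/eqP; rewrite -normr_eq0 -sqrf_eq0.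
    by apply/eqP; apply: (psumr_eq0P _ sum0) => // j' _; rewrite exprn_ge0.
  have uPA : P *m A \in unitmx by rewrite unitmx_mul spectral_unit.
  have := congr1 (mulmx^~ (invmx (P *m A))) rs0; rewrite rowE mulmxK // mul0mx.
  by move=> /rowP/(_ s)/eqP; rewrite !mxE !eqxx oner_eq0.
have spR s : (complex.Re (sp 0 s))%:C = sp 0 s by rewrite RRe_real // gtr0_real.
have [p pS] := sorting_perm (fun s => complex.Re (sp 0 s)).
have [|//|t [r [t0 r01 rfst lamE]]] := @scales_ratio n (fun s => complex.Re (sp 0 (p s))).
  by move=> s; rewrite -(ltcR 0) spR.
pose w := col_perm p (P^t* ).
have wE : A *m A^t* = herm_of w (fun s => complex.Re (sp 0 (p s))).
  rewrite (@herm_of_col_perm n (P^t* ) (fun s => complex.Re (sp 0 s))) -/H HE.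
  rewrite /herm_of invmx_unitary // trmxCK; congr (_ *m diag_mx _ *m _).
  by apply/rowP => s; rewrite mxE spR.
have uw : w *m w^t* = 1%:M.
  have E (M : 'M[R[i]]_n) : herm_of M (fun=> 1) = M *m M^t*.
    rewrite /herm_of (_ : diag_mx _ = 1%:M) ?mulmx1 //.
    by apply/matrixP => b c; rewrite !mxE.
  by rewrite -E (@herm_of_col_perm n (P^t* ) (fun=> 1)) E trmxCK -invmx_unitary // mulVmx ?spectral_unit.
have detw : sqmod (\det w) = 1.
  apply: complexI; rewrite sqmodE normCK rmorph1; have := congr1 determinant uw.
  by rewrite det_mulmx det_map_mx det_tr det1.
exists w, t, r; split=> //.
  rewrite wE /herm_of scalemxAl scalemxAr; congr (_ *m _ *m _).
  apply/matrixP => b c; rewrite !mxE lamE.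
  by case: (b == c); rewrite ?mulr1n ?mulr0n ?mulr0 // rmorphM.
split=> // b c.
have : sqmod (w b c) <= 1.
  have /matrixP/(_ b b) := uw; rewrite mxE [RHS]mxE eqxx => sum1.
  rewrite -lecR sqmodE rmorph1 -[leRHS]sum1 (bigD1 c) //= !mxE -normCK lerDl.
  by apply: sumr_ge0 => j _; rewrite !mxE mul_conjC_ge0.
rewrite /sqmod; case: (w b c) => x y /= xy; split; apply/andP; split; nra.
Qed.

End NormalForm.

(** Converts minimality of the objective into the inequality between determinants: [d] and [d0] are
    the denominators, [c] the product of factorials from Cauchy-Binet, [t] the scale factor and [D]
    the power of [|\det h|]. *)
Lemma ler_cross_mul (F : numFieldType) (D x y t d d0 c : F) :
  0 < t -> 0 < d0 -> 0 < c -> D * d0 = t * d -> c * x * d <= c * y * d0 -> D * x <= t * y.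
Proof.
move=> t0 d00 c0 E; rewrite -!mulrA ler_pM2l // => le.
rewrite -(ler_pM2r d00) mulrAC E -!mulrA ler_pM2l // mulrC //.
Qed.

Section BalancedFrame.
Variables (R : realType) (I : finType) (n : nat) (k : I -> nat).
Variables (B : forall i, 'M[R[i]]_(k i, n)) (a : I -> nat) (g : nat).
Hypothesis g_gt0 : (0 < g)%N.
Hypothesis freeB : forall i, row_free (B i).
Hypothesis balanced : (\sum_i a i * k i = g * n)%N.
Hypothesis stable : forall E : 'M[R[i]]_n, (0 < \rank E < n)%N ->
  (\sum_i a i * \rank (B i :&: E)%MS < g * \rank E)%N.

Let gramdet (H : 'M[R[i]]_n) : R[i] := \prod_i \det (B i *m H *m (B i)^t* ) ^+ a i.

Let kappa : R[i] := \prod_i (k i)`!%:R ^+ a i.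

Let gramdetE (w : 'M[R[i]]_n) (r : 'I_n -> R) : (objective_num B a w r)%:C = kappa * gramdet (herm_of w (scales r)).
Proof.
rewrite /objective_num rmorph_prod /kappa /gramdet -big_split /=.
by apply: eq_bigr => i _; rewrite rmorphXn /= gram_weightE exprMn.
Qed.

Let gramdetZ t H : gramdet (t *: H) = t ^+ (g * n) * gramdet H.
Proof.
rewrite /gramdet -balanced expr_sum -big_split /=; apply: eq_bigr => i _.
by rewrite -scalemxAr -scalemxAl detZ exprMn -exprM mulnC.
Qed.

Let gramdet_gram m (A : 'M[R[i]]_(n, m)) :
  gramdet (A *m A^t* ) = \prod_i \det ((B i *m A) *m (B i *m A)^t* ) ^+ a i.
Proof. by apply: eq_bigr => i _; rewrite trmx_mul map_mxM !mulmxA. Qed.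

Let gram_shift i (A h : 'M[R[i]]_n) :
  B i *m A *m h *m h^t* *m (B i *m A)^t* = (B i *m (A *m h)) *m (B i *m (A *m h))^t*.
Proof. by rewrite !trmx_mul !map_mxM !mulmxA. Qed.

Let det_herm (w : 'M[R[i]]_n) (r : 'I_n -> R) : \det (herm_of w (scales r)) ^+ g =
  (sqmod (\det w))%:C ^+ g * (objective_den g r)%:C.
Proof.
rewrite /herm_of !det_mulmx det_diag det_map_mx det_tr mulrAC -normCK -sqmodE exprMn.
congr (_ * _); rewrite rmorphXn rmorph_prod; congr (_ ^+ _).
by apply: eq_bigr => s _; rewrite mxE.
Qed.

(** With [K] a square root of the minimizing form, passing from [B i] to [B i *m K] moves the
    minimum to [h] = 1, where [critical_frame] applies. A competitor [h] gives the Gram matrix of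
    [K *m h], and balance absorbs the scale of its normal form. *)
Lemma balanced_frame : exists2 K : 'M[R[i]]_n, K \in unitmx &
  \sum_i (a i)%:R *: frame_projection (fun i => B i *m K) i = g%:R%:M.
Proof.
have [w0 [r0 [detw0 r0_gt0 min0]]] := objective_minimizer freeB balanced stable.
have [K KK] : exists K : 'M[R[i]]_n, K *m K^t* = herm_of w0 (scales r0).
  exists (w0 *m diag_mx (\row_s (Num.sqrt (scales r0 s))%:C)).
  rewrite trmx_mul map_mxM mulmxA /herm_of tr_diag_mx map_diag_mx -[w0 *m _ *m _]mulmxA.
  congr (_ *m _ *m _); apply/matrixP => b c; rewrite mul_diag_mx !mxE.
  case: eqVneq => [->|_]; rewrite ?mulr1n ?mulr0n ?mulr0 //.
  rewrite [X in _ * X](_ : _ = (Num.sqrt (scales r0 c))%:C); last first.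
    by apply/CrealP; rewrite complex_real.
  rewrite -rmorphM /= -expr2 sqr_sqrtr // ltW //.
  exact: scales_gt0.
have den0 := objective_den_gt0 g r0_gt0.
have detK : `|\det K| ^+ (2 * g) = (objective_den g r0)%:C.
  rewrite exprM normCK; have := det_herm w0 r0; rewrite -KK detw0 rmorph1 expr1n mul1r => <-.
  by rewrite [\det (K *m K^t* )]det_mulmx det_map_mx det_tr.
have uK : K \in unitmx.
  rewrite unitmxE unitfE; apply/negP => /eqP K0; move: detK; rewrite K0 normr0 expr0n.
  rewrite muln_eq0 /= eqn0Ngt g_gt0 /= => /esym/eqP; rewrite fmorph_eq0.
  by rewrite gt_eqF.
exists K => //; have kappa_gt0 : 0 < kappa.
  by apply: prodr_gt0 => i _; rewrite exprn_gt0 // ltr0n fact_gt0.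
apply: critical_frame => [h|i]; last first.
  by apply: det_gram_gt0; rewrite /row_free mxrankMfree ?row_free_unit //; apply: freeB.
have E1 : \prod_i \det (B i *m K *m (B i *m K)^t* ) ^+ a i = gramdet (K *m K^t* ).
  by rewrite gramdet_gram.
have E2 : \prod_i \det (B i *m K *m h *m h^t* *m (B i *m K)^t* ) ^+ a i =
    gramdet ((K *m h) *m (K *m h)^t* ).
  by rewrite gramdet_gram; apply: eq_bigr => i _; rewrite gram_shift.
(* For singular [h] there is no normal form, but the left-hand side is 0 since [g] is positive. *)
rewrite [X in _ * X]E1 [leRHS]E2; have [h0|h0] := eqVneq (\det h) 0.
  rewrite h0 normr0 expr0n muln_eq0 /= eqn0Ngt g_gt0 mul0r gramdet_gram.
  by apply: prodr_ge0 => i _; apply/exprn_ge0/det_gram_ge0.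
have uKh : K *m h \in unitmx by rewrite unitmx_mul uK unitmxE unitfE.
have [w [t [r [HE t0 [wP detw] r01 rfst]]]] := posdef_normal_form uKh.
rewrite HE gramdetZ.
have rgt0 j : 0 < r j by case/andP: (r01 j).
have deth : `|\det h| ^+ (2 * g) * (objective_den g r0)%:C =
    t%:C ^+ (g * n) * (objective_den g r)%:C.
  rewrite -detK -exprMn -normrM mulrC -det_mulmx exprM normCK.
  have -> : \det (K *m h) * conjC (\det (K *m h)) = \det ((K *m h) *m (K *m h)^t* ).
    by rewrite [RHS]det_mulmx det_map_mx det_tr.
  by rewrite HE detZ exprMn -exprM det_herm detw rmorph1 expr1n mul1r mulnC.
have tC : 0 < t%:C ^+ (g * n) :> R[i] by rewrite exprn_gt0 // ltcR.
have denC : 0 < (objective_den g r0)%:C :> R[i] by rewrite ltcR.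
have minC : (objective_num B a w0 r0)%:C * (objective_den g r)%:C <=
    (objective_num B a w r)%:C * (objective_den g r0)%:C.
  by rewrite -!rmorphM lecR; apply: min0.
move: minC; rewrite !gramdetE -KK; exact: (ler_cross_mul tC denC kappa_gt0 deth).
Qed.

End BalancedFrame.

End HermitianMatrices.

(** * Unitarization *)

Section Coordinates.
Local Open Scope sesquilinear_scope.
Import VectorInternalTheory.
Variables (C : numClosedFieldType) (V : vectType C).

Lemma mem_vs2mx (U : {vspace V}) v : (v \in U) = (v2r v <= vs2mx U)%MS.
Proof. by rewrite memvE /subsetv mx2vsK. Qed.

Lemma vs2mx_cap (U W : {vspace V}) : (vs2mx (U :&: W)%VS :=: vs2mx U :&: vs2mx W)%MS.
Proof. exact: mx2vsK. Qed.

Section PullbackForm.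
Variable K : 'M[C]_(dim V).
Hypothesis uK : K \in unitmx.

(** The form whose matrix in the coordinates of [V] is [K] times its adjoint. *)
Definition pullback_form (u v : V) : C := dotmx (v2r u *m K) (v2r v *m K).

Lemma pullback_form_bilinear : bilinear_for
  (GRing.Scale.Law.clone _ _ *%R _) (GRing.Scale.Law.clone _ _ (conjC \; *%R) _) pullback_form.
Proof.
split=> [u' a u v|u a v w]; rewrite /pullback_form !linearP /= mulmxDl -scalemxAl.
  by rewrite !dotmxE mulmxDl -scalemxAl !mxE.
by rewrite !dotmxE linearD /= linearZ /= map_mxD map_mxZ mulmxDr -scalemxAr !mxE.
Qed.

HB.instance Definition _ := bilinear_isBilinear.Build C V V C _ _ pullback_form
  pullback_form_bilinear.

Lemma pullback_form_hermitian u v :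
  pullback_form u v = (-1) ^+ false * conjC (pullback_form v u).
Proof.
rewrite expr0 mul1r /pullback_form !dotmxE !mxE rmorph_sum; apply: eq_bigr => j _.
by rewrite !mxE rmorphM /= conjCK mulrC.
Qed.

HB.instance Definition _ := isHermitianSesquilinear.Build C V false conjC pullback_form
  pullback_form_hermitian.

Lemma pullback_form_gt0 u : u != 0 -> 0 < pullback_form u u.
Proof.
move=> u0; apply: dotmx_is_dotmx.
apply: contraNneq u0 => /(congr1 (mulmx^~ (invmx K))); rewrite mulmxK // mul0mx => E.
by apply/eqP/v2r_inj; rewrite E linear0.
Qed.

HB.instance Definition _ := isDotProduct.Build C V pullback_form pullback_form_gt0.

Definition pullback_dot : {dot V for conjC} := pullback_form.

End PullbackForm.

End Coordinates.

Section Unitarization.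
Local Open Scope sesquilinear_scope.
Local Open Scope complex_scope.
Import VectorInternalTheory.
Variables (R : realType) (d : Order.disp_t) (T : finPOrderType d) (X : linrep R[i] T).
Let V := rep_space X.

Lemma unitarizable_of_stable (a : T -> nat) (g : nat) : (0 < g)%N ->
  (\sum_i a i * \dim (rep_sub X i) = g * \dim {: V})%N ->
  (forall U : {vspace V}, (0 < \dim U < \dim {: V})%N ->
     (\sum_i a i * \dim (rep_sub X i :&: U) < g * \dim U)%N) ->
  unitarizable_with X (fun i => (a i)%:R) g%:R.
Proof.
move=> g0 bal stab; rewrite dimvf in bal stab.
have [B freeB BE] : exists2 B : forall i, 'M[R[i]]_(\dim (rep_sub X i), dim V),
    forall i, row_free (B i) & forall i, (B i :=: vs2mx (rep_sub X i))%MS.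
  exists (fun i => row_base (vs2mx (rep_sub X i))) => i; first exact: row_base_free.
  exact: eq_row_base.
have [|K uK KP] := balanced_frame (B := B) (a := a) g0 freeB bal.
  move=> E rE; have dimE : \dim (mx2vs E) = \rank E by rewrite /dimv mx2vsK.
  rewrite -dimE in rE *; have := stab _ rE.
  apply: leq_trans; rewrite ltnS; apply: leq_sum => i _; rewrite leq_mul2l; apply/orP; right.
  rewrite /dimv vs2mx_cap; apply: mxrankS; apply: capmxS; first by rewrite BE.
  by rewrite mx2vsK.
pose M i := B i *m K; pose Q i := frame_projection M i.
have gram_unit i : M i *m (M i)^t* \in unitmx.
  rewrite unitmxE unitfE gt_eqF // det_gram_gt0 // /row_free mxrankMfree ?row_free_unit //.
  exact: freeB.
(* [Q i] projects onto the row space of [B i *m K]; conjugation by [K] turns this into a projection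
   onto the row space of [B i], that is onto [rep_sub X i], orthogonal for the pulled back form. *)
pose P i : 'End(V) := linfun (fun v => r2v (v2r v *m K *m Q i *m invmx K)).
have PE i v : v2r (P i v) *m K = v2r v *m K *m Q i.
  rewrite /P linfun_linear ?r2vK ?mulmxKV // => c u w.
  by rewrite !linearP /= !mulmxDl -!scalemxAl linearP.
have v2rK_inj u v : v2r u *m K = v2r v *m K -> u = v.
  by move=> /(congr1 (mulmx^~ (invmx K))); rewrite !mulmxK // => /v2r_inj.
exists (pullback_dot uK), P; split=> [i v|].
  split=> [|u].
    rewrite mem_vs2mx -[v2r _](mulmxK uK) PE.
    have -> : Q i = (M i)^t* *m invmx (M i *m (M i)^t* ) *m B i *m K.
      by rewrite /Q /frame_projection -[RHS]mulmxA.
    by rewrite !mulmxA mulmxK // -BE submxMl.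
  rewrite mem_vs2mx -BE => /submxP[y uE].
  rewrite -[LHS]/(dotmx (v2r (v - P i v) *m K) (v2r u *m K)) dotmxE uE.
  rewrite linearB mulmxBl PE -[y *m _ *m K]mulmxA -/(M i) trmx_mul map_mxM.
  have -> : (v2r v *m K - v2r v *m K *m Q i) *m ((M i)^t* *m y^t* ) =
      (v2r v *m K *m (M i)^t* - v2r v *m K *m (Q i *m (M i)^t* )) *m y^t*.
    by rewrite !mulmxA mulmxBl.
  have -> : Q i *m (M i)^t* = (M i)^t*.
    exact: frame_projection_adj.
  by rewrite subrr mul0mx mxE.
apply/lfunP => v; apply: v2rK_inj.
have -> : v2r ((\sum_i (a i)%:R%:C *: P i)%VF v) *m K = v2r v *m K *m \sum_i (a i)%:R *: Q i.
  rewrite sum_lfunE linear_sum mulmx_suml mulmx_sumr; apply: eq_bigr => i _.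
  by rewrite scale_lfunE linearZ /= -scalemxAl PE -scalemxAr rmorph_nat.
by rewrite KP scale_lfunE id_lfunE linearZ /= -scalemxAl mul_mx_scalar rmorph_nat.
Qed.

Lemma unitarizable_dim0 : \dim {: V} = 0%N -> unitarizable_with X (fun=> 1) 1.
Proof.
move=> V0; have all0 (u v : V) : u = v.
  suff z (w : V) : w = 0 by rewrite (z u) (z v).
  by apply/eqP; rewrite -memv0 -(_ : fullv = 0%VS) ?memvf //; apply/eqP; rewrite -dimv_eq0 V0.
have u1 : 1%:M \in @unitmx R[i] (dim V) by apply: unitmx1.
exists (pullback_dot u1), (fun=> 0); split=> [i v|]; last by apply/lfunP => v; apply: all0.
rewrite (all0 v 0); split=> [|u _]; first by rewrite linear0 mem0v.
by rewrite linear0 subr0 linear0l.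
Qed.

End Unitarization.

(** When all subspaces are 0 every endomorphism of the space is a morphism, in particular the
    projection onto a line; so the whole space is that line. *)
Lemma indecomposable_null (F : fieldType) d (T : finPOrderType d) (X : linrep F T) :
  linrep_indecomposable X -> \dim {: rep_space X} != 0%N ->
  (forall i, rep_sub X i = 0%VS) -> linrep_iso X (null_linrep F T).
Proof.
move=> indX V0 X0; pose v := vpick {: rep_space X}.
have v0 : v != 0 by rewrite vpick0 -dimv_eq0.
pose D : 'Hom(F^o, rep_space X) := linfun (fun c : F^o => (c : F) *: v).
have DE c : D c = (c : F) *: v.
  by rewrite /D linfun_linear // => b x y; rewrite scalerDl scalerA.
have kerD : lker D == 0%VS.
  apply/lker0P => x y; rewrite !DE => /eqP; rewrite -subr_eq0 -scalerBl scaler_eq0.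
  by rewrite (negPf v0) orbF subr_eq0 => /eqP.
have limD : limg D = fullv.
  case: (indecomposable_idempotent (e := projv <[v]>) indX).
  - by move=> i w; rewrite !X0 !memv0 => /eqP->; rewrite linear0.
  - exact: projv_proj.
  - move=> /lfunP/(_ v); rewrite projv_id ?memv_line // zero_lfunE => E.
    by rewrite E eqxx in v0.
  move=> E; apply/vspaceP => w; rewrite memvf.
  have := memv_proj <[v]> w; rewrite E id_lfunE => /vlineP[c ->].
  by rewrite -(DE c) memv_img ?memvf.
exists (D^-1)%VF; split; last by move=> i; rewrite X0 limg0.
exists D => [w|c]; last exact: lker0_lfunK.
by rewrite limg_lfunVK // limD memvf.
Qed.

Theorem proposition3p1 (R : realType) (d : Order.disp_t) (T : finPOrderType d)
    (pi : linrep R[i] T) :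
  primitive_poset T ->
  finite_rep_type R[i] T ->
  linrep_indecomposable pi ->
  ~ linrep_iso pi (null_linrep R[i] T) ->
  exists (alpha : T -> R) (gamma : R),
    [/\ forall i, 0 < alpha i, 0 < gamma & unitarizable_with pi alpha gamma].
Proof.
move=> [m [k [h [_ [h' hK h'K] hle]]]] ft indpi not_null.
have [pi0|pi0] := eqVneq (\dim {: rep_space pi}) 0%N.
  by exists (fun=> 1), 1; split=> //; apply: unitarizable_dim0.
have [brk rig] := finite_type_rigid hK h'K hle ft indpi.
have [a [g [a_gt0 bal stab]]] := positive_stable_weight hK h'K hle brk rig.
(* If [g] is 0, balance with positive weights leaves only zero subspaces, the excluded
   representation. *)
have [g0|g0] := posnP g.
  case: not_null; apply: indecomposable_null => // i; apply/eqP; rewrite -dimv_eq0.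
  move/eqP: bal; rewrite g0 mul0n sum_nat_eq0 => /forallP/(_ i).
  by rewrite /= muln_eq0 eqn0Ngt a_gt0.
exists (fun i => (a i)%:R), g%:R; split=> [i||]; rewrite ?ltr0n //.
exact: unitarizable_of_stable.
Qed.
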